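(* Let $(a_n)_{n\ge 1}$ be a positive, real-valued lacunary sequence. Let $\epsilon>0$, and let $L=L(N)>0$ be a real-valued function of $N\in\mathbb{N}$ such that $L(N)=O(N^{1/2-\epsilon})$ and $L(N+1)-L(N)=o(N^{-1/2})$ as $N\to\infty$. Then for (Lebesgue) almost all $\alpha\in\mathbb{R}$, $$\Sigma_N^2(L,\alpha)=L+o(L)$$ as $N\to\infty$.
   Context: A positive, real-valued lacunary sequence is a real sequence $(a_n)_{n\ge1}$ with $a_1>0$ for which there is a constant $C>1$ such that $a_{n+1}\ge C a_n$ for all $n\ge1$. Let $\chi=\chi_{[-1/2,1/2]}$ be the characteristic function of $[-1/2,1/2]$. For $\alpha\in\mathbb{R}$, $x\in[0,1)$, put $$S_N(L,\alpha)(x)=\sum_{j=1}^N\sum_{n\in\mathbb{Z}}\chi\left(\frac{\alpha a_j-x+n}{L/N}\right),\qquad \Sigma_N^2(L,\alpha)=\int_0^1\left(S_N(L,\alpha)(x)-L\right)^2dx,$$ with $L=L(N)$. *)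

(* Defs.v *)
From HB Require Import structures.
From mathcomp Require Import all_boot all_order all_algebra.
From mathcomp Require Import all_classical all_reals all_analysis.
From mathcomp Require Import zify.

Set Implicit Arguments.
Unset Strict Implicit.
Unset Printing Implicit Defensive.

Import Order.TTheory GRing.Theory Num.Theory.
Import numFieldNormedType.Exports.

Local Open Scope classical_set_scope.
Local Open Scope ring_scope.

(* Sequences are indexed from 1: the value [a 0] is never used. *)
Definition lacunary (R : realType) (a : nat -> R) : Prop :=
  0 < a 1%N /\
  exists2 C : R, 1 < C & forall n : nat, (1 <= n)%N -> C * a n <= a n.+1.

Definition chi (R : realType) : R -> R := \1_`[- 2^-1, 2^-1].

(* In [S_N] and [Sigma2] the argument [l] is the value L(N). The sum over int
   is the sum over the finite support of the summand; it is the genuine sum,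
   since [chi] has bounded support and [l / N != 0] when [l > 0] and [N > 0]. *)
Definition S_N (R : realType) (a : nat -> R) (N : nat) (l alpha x : R) : R :=
  \sum_(1 <= j < N.+1) \sum_(n \in [set: int])
    chi ((alpha * a j - x + n%:~R) / (l / N%:R)).

Definition Sigma2 (R : realType) (a : nat -> R) (N : nat) (l alpha : R) : R :=
  \int[@lebesgue_measure R]_(x in `[0, 1]) (S_N a N l alpha x - l) ^+ 2.

(* Checks the claim above on the sum over int. *)
Lemma finite_support_chi (R : realType) (y w : R) : 0 < w ->
  finite_set [set n : int | chi ((y + n%:~R) / w) != 0].
Proof.
move=> w0; set M := `|Num.ceil (`|y| + w)|%N.
have fin : finite_set [set i%:Z - M%:Z | i in `I_(M + M).+1].
  exact/finite_image/finite_II.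
apply: sub_finite_set fin => n /=; change int in (type of n).
rewrite /chi indicE; case: (boolP (_ \in _)) => [|_]; last by rewrite eqxx.
rewrite inE /= in_itv /= => /andP[h1 h2] _.
have hn : `|n%:~R : R| <= `|y| + w.
  have -> : (n%:~R : R) = (y + n%:~R) - y by rewrite addrC addKr.
  rewrite (le_trans (ler_normB _ _))// addrC lerD2l.
  have : `|(y + n%:~R) / w| <= 2^-1 by rewrite ler_norml h1 h2.
  rewrite normrM normfV (gtr0_norm w0) ler_pdivrMr// => /le_trans; apply.
  by apply: ler_piMl; [exact: ltW | rewrite invf_le1// ler1n].
have hM : `|n| <= M%:Z.
  rewrite -(ler_int R) intr_norm (le_trans hn)// (le_trans (ceil_ge _))//.
  by rewrite ler_int /M abszE ler_norm.
move: hM; rewrite ler_norml => /andP[h3 h4].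
exists (absz (n + M%:Z)%R); rewrite /=; lia.
Qed.

(* Main.v *)
Require Import Defs.
From HB Require Import structures.
From mathcomp Require Import all_boot all_order all_algebra.
From mathcomp Require Import all_classical all_reals all_analysis.
From mathcomp Require Import measurable_realfun.
From mathcomp Require Import zify ring lra.
Import Order.TTheory GRing.Theory Num.Theory.
Import numFieldNormedType.Exports.
Local Open Scope classical_set_scope.
Local Open Scope ring_scope.

(** Write [w = L N / N] for the width of the window, [||y||] for the distance
    from [y] to the nearest integer, and [tri w y = max 0 (1 - ||y|| / w)].  The
    overlap of two arcs of length [w] on the circle whose centres differ by [y]
    has length [w * tri w y] (lemma [segint_box2]).  Expanding the square
    therefore gives (lemma [Sigma2E])
      [Sigma2 = L - L^2 + 2 w * sum over k < j <= N of tri w (alpha (a_j - a_k))],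
    so that the theorem says that the pair sum, multiplied by [2 / N], is
    [L + o(1)]: for almost all [alpha] it is close to its mean, [tri w] having
    mean [w] over a period.

    The fluctuation is bounded in mean square over a bounded range of [alpha].
    Put [ctri w = tri w - w], a 1-periodic Lipschitz function of mean zero, and
    [F_j (alpha) = sum over k < j of ctri w (alpha (a_j - a_k))].  By lacunarity,
    indices that differ by at least [D] correspond to frequencies whose ratio is
    at least of order [C^D], and a shift of [alpha] can then average out one
    factor of a product while hardly moving the other one.  Two consequences:
    - if [j >= j' + D], the terms of [F_j'] are almost constant on a period of any
      term of [F_j], hence [F_j] and [F_j'] are nearly uncorrelated;
    - in the expansion of [F_j^2], the terms [alpha (a_j - a_k)] and
      [alpha (a_j - a_k')] with [k' < k] differ by the slow quantity
      [alpha (a_k - a_k')], and they are nearly uncorrelated as soon as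
      [D <= k <= j - D].
    In the remaining cases the trivial bound suffices, namely that [|ctri w|] has
    mean at most [2 w].  With [D] of order [log N] the errors are negligible, and
    the mean square of the sum of the [F_j] is at most of order [D^2 N^2 w]
    (lemmas [variance_bound] and [variance_arith]).

    Since [w = O(N^(-1/2-eps))], after division by [N^2] this is summable along
    the squares [N = m^2], so the normalized fluctuation tends to zero almost
    everywhere along the squares (lemma [pair_discrepancy_ae]).  The pair sum is
    nondecreasing in [N] and in [w]; for [m^2 <= N < (m+1)^2] it is thus enclosed
    between its values at the two squares, with widths built from [L (m^2)] plus
    or minus a constant [eta].  The hypothesis [L (N+1) - L N = o(N^(-1/2))]
    implies that [L] varies by [o(1)] on such a block, whose length is of order
    [N^(1/2)] (lemma [slow_variation]).  The widths depend on [eta] and [m] only,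
    so it is enough to let [eta] run through the countable set of the
    [1 / (p+1)]. *)

(** * Integrals of bounded measurable functions over segments *)

Section SegmentIntegral.
Context (R : realType).
Local Notation mu := (@lebesgue_measure R).
Implicit Types (f g : R -> R) (p q r c : R).

(** This class is closed under all the operations used here, and all its members
    are integrable over every segment, so that integrability never needs an
    argument of its own.  It contains the discontinuous indicator [box] as well
    as the continuous [tri]. *)
Definition bmeas f := measurable_fun [set: R] f /\ exists M, forall x, `|f x| <= M.

Definition segint p q f : R := \int[mu]_(x in `[p, q]) f x.

Lemma bmeas_integrable p q f : bmeas f -> mu.-integrable `[p, q] (EFin \o f).
Proof.
move=> [mf [M fM]]; apply: measurable_bounded_integrable => //.
- exact/compact_finite_measure/segment_compact.
- exact: measurable_funTS.
- exists M; split; rewrite ?num_real// => N MN x _.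
  by apply: (le_trans (fM x)); exact: ltW.
Qed.

Lemma bmeas_cst c : bmeas (fun=> c).
Proof. by split; [exact: measurable_cst | exists `|c|]. Qed.

Lemma bmeasD f g : bmeas f -> bmeas g -> bmeas (fun x => f x + g x).
Proof.
move=> [mf [M fM]] [mg [N gN]]; split; first exact: measurable_funD.
by exists (M + N) => x; rewrite (le_trans (ler_normD _ _))// lerD.
Qed.

Lemma bmeasM f g : bmeas f -> bmeas g -> bmeas (fun x => f x * g x).
Proof.
move=> [mf [M fM]] [mg [N gN]]; split; first exact: measurable_funM.
by exists (M * N) => x; rewrite normrM ler_pM.
Qed.

Lemma bmeasZ c f : bmeas f -> bmeas (fun x => c * f x).
Proof. exact/bmeasM/bmeas_cst. Qed.

Lemma bmeasN f : bmeas f -> bmeas (fun x => - f x).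
Proof.
by move=> [mf [M fM]]; split; [exact: measurableT_comp | exists M => x; rewrite normrN].
Qed.

Lemma bmeasB f g : bmeas f -> bmeas g -> bmeas (fun x => f x - g x).
Proof. by move=> bf bg; exact/bmeasD/bmeasN. Qed.

Lemma bmeas_norm f : bmeas f -> bmeas (fun x => `|f x|).
Proof.
move=> [mf [M fM]]; split; first exact: measurableT_comp.
by exists M => x; rewrite normr_id.
Qed.

Lemma bmeas_sum (I : Type) (s : seq I) (P : pred I) (F : I -> R -> R) :
  (forall i, bmeas (F i)) -> bmeas (fun x => \sum_(i <- s | P i) F i x).
Proof.
move=> bF; elim: s => [|i s IH].
  by under eq_fun do rewrite big_nil; exact: bmeas_cst.
under eq_fun do rewrite big_cons; case: (P i) => //.
exact: bmeasD.
Qed.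

Lemma bmeas_shift c f : bmeas f -> bmeas (fun x => f (x + c)).
Proof.
move=> [mf [M fM]]; split; last by exists M.
by apply: (measurableT_comp mf); exact: measurable_funD.
Qed.

Lemma eq_segint p q f g : (forall x, p <= x <= q -> f x = g x) ->
  segint p q f = segint p q g.
Proof. by move=> fg; apply: eq_Rintegral => x /[!inE]/=; rewrite in_itv/= => /fg. Qed.

Lemma segintD p q f g : bmeas f -> bmeas g ->
  segint p q (fun x => f x + g x) = segint p q f + segint p q g.
Proof. by move=> bf bg; apply: RintegralD => //; exact: bmeas_integrable. Qed.

Lemma segintB p q f g : bmeas f -> bmeas g ->
  segint p q (fun x => f x - g x) = segint p q f - segint p q g.
Proof. by move=> bf bg; apply: RintegralB => //; exact: bmeas_integrable. Qed.

Lemma segintZ p q c f : bmeas f ->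
  segint p q (fun x => c * f x) = c * segint p q f.
Proof. by move=> bf; apply: RintegralZl => //; exact: bmeas_integrable. Qed.

Lemma segint_cst p q c : p <= q -> segint p q (fun=> c) = c * (q - p).
Proof.
move=> pq; rewrite /segint Rintegral_cst//= lebesgue_measure_itv/= lte_fin.
by case: ltgtP pq => // ->; rewrite subrr.
Qed.

Lemma segint_sum (I : Type) (s : seq I) (P : pred I) (F : I -> R -> R) p q :
  (forall i, bmeas (F i)) ->
  segint p q (fun x => \sum_(i <- s | P i) F i x) =
  \sum_(i <- s | P i) segint p q (F i).
Proof.
move=> bF; elim: s => [|i s IH].
  rewrite big_nil (@eq_segint _ _ _ (fun=> 0)) => [|x _]; last by rewrite big_nil.
  by rewrite /segint Rintegral_cst// mul0r.
rewrite big_cons -IH; case: ifPn => Pi.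
  rewrite -segintD//; last exact: bmeas_sum.
  by apply: eq_segint => x _; rewrite big_cons Pi.
by apply: eq_segint => x _; rewrite big_cons (negbTE Pi).
Qed.

Lemma le_segint p q f g : bmeas f -> bmeas g ->
  (forall x, p <= x <= q -> f x <= g x) -> segint p q f <= segint p q g.
Proof.
move=> bf bg fg; apply: le_Rintegral => //; exact: bmeas_integrable.
Qed.

Lemma segint_ge0 p q f : (forall x, 0 <= f x) -> 0 <= segint p q f.
Proof. by move=> f0; apply: Rintegral_ge0. Qed.

Lemma segint_norm p q f : bmeas f -> `|segint p q f| <= segint p q (fun x => `|f x|).
Proof. by move=> bf; apply: le_normr_Rintegral => //; exact: bmeas_integrable. Qed.

Lemma segint_normM p q f M : p <= q -> bmeas f ->
  (forall x, p <= x <= q -> `|f x| <= M) ->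
  `|segint p q f| <= M * (q - p).
Proof.
move=> pq bf fM; rewrite (le_trans (segint_norm _ _ _ bf))// -segint_cst//.
apply: le_segint => //; [exact: bmeas_norm|exact: bmeas_cst].
Qed.

Lemma segint_cat p r q f : bmeas f -> p <= r -> r <= q ->
  segint p q f = segint p r f + segint r q f.
Proof.
move=> bf pr rq; rewrite [LHS](_ : _ = segint p r f + (segint p q f - segint p r f)); last first.
  by rewrite addrC subrK.
congr (_ + _); rewrite /segint Rintegral_itvB ?bnd_simp//; last exact: bmeas_integrable.
rewrite Rintegral_itv_obnd_cbnd//.
by apply: integrableS (bmeas_integrable r q _ bf) => //; exact: subset_itv_oc_cc.
Qed.

Let shift c : measurableTypeR R -> measurableTypeR R := fun x => x + c.

Let measurable_shift c : measurable_fun [set: measurableTypeR R] (shift c).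
Proof. exact: measurable_funD. Qed.

(** Translation invariance: the pushforward agrees with the Lebesgue measure on
    half-open intervals, which determine a measure. *)
Lemma lebesgue_shift c (A : set R) : measurable A ->
  mu A = pushforward mu (shift c) A.
Proof.
move=> mA.
apply: lebesgue_measure_unique => //= _ /ocitvP[->|[[p q] /= pq ->]].
  by rewrite !measure0.
rewrite /pushforward /shift.
have -> : (fun x => x + c) @^-1` `]p, q] = [set` `]p - c, q - c]].
  by apply/seteqP; split => x /=; rewrite !in_itv/= ltrBlDr lerBrDr.
by rewrite !lebesgue_measure_itv/= !lte_fin ltrD2r pq -!EFinD opprD opprK addrACA addNr addr0.
Qed.

Lemma segint_shift p q c f : bmeas f ->
  segint p q (fun x => f (x + c)) = segint (p + c) (q + c) f.
Proof.
move=> bf; rewrite /segint /Rintegral; congr fine.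
have pre : [set` `[p, q]] = shift c @^-1` `[p + c, q + c] :> set R.
  by apply/seteqP; split => x /=; rewrite !in_itv/= !lerD2r.
rewrite pre -(@integral_pushforward _ _ _ _ _ _ (measurable_shift c) mu _ (EFin \o f))//.
- by apply: eq_measure_integral => A mA _; exact/esym/lebesgue_shift.
- by apply/measurable_EFinP; case: bf.
- by rewrite -pre; exact: (bmeas_integrable p q _ (bmeas_shift c _ bf)).
Qed.

(** A translation by an integer brings the segment to [[r, r + 1]] with
    [0 <= r < 1]; the piece beyond 1 then goes back to [[0, r]]. *)
Lemma segint_period p f : bmeas f -> (forall x (n : int), f (x + n%:~R) = f x) ->
  segint p (p + 1) f = segint 0 1 f.
Proof.
move=> bf fper; set n := Num.floor p; set r := p - n%:~R.
have r0 : 0 <= r by rewrite subr_ge0 floor_le.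
have r1 : r <= 1 by rewrite lerBlDr ltW// addrC (lt_le_trans (floorD1_gt _))// intrD addrC.
have -> : segint p (p + 1) f = segint r (r + 1) f.
  transitivity (segint (r + n%:~R) (r + 1 + n%:~R) f).
    by rewrite subrK addrAC subrK.
  by rewrite -segint_shift//; apply: eq_segint => x _; exact: fper.
rewrite (@segint_cat r 1) ?lerDr// (@segint_cat 0 r 1)// [RHS]addrC; congr (_ + _).
rewrite -{1}(add0r 1) -segint_shift//; apply: eq_segint => x _; exact: (fper x 1).
Qed.

Lemma bmeas_lincomp b f : bmeas f -> bmeas (fun x => f (x * b)).
Proof.
move=> [mf [M fM]]; split; last by exists M.
by apply: (measurableT_comp mf); exact: measurable_funM.
Qed.

End SegmentIntegral.

(** * Distance to the nearest integer and the triangle function *)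

Section NearestInteger.
Context (R : realType).
Implicit Types (y z w : R) (n : int).

Definition nearest y : int := Num.floor (y + 2^-1).

Definition ndist y : R := `|y - (nearest y)%:~R|.

Lemma ndist_ge0 y : 0 <= ndist y.
Proof. exact: normr_ge0. Qed.

Lemma ndist_le_half y : ndist y <= 2^-1.
Proof.
rewrite /ndist /nearest ler_norml.
have := floor_itv (y + 2^-1); rewrite intrD; lra.
Qed.

Lemma ndist_away y n : n != nearest y -> 2^-1 <= `|y - n%:~R|.
Proof.
move=> nm.
have := ndist_le_half y; rewrite /ndist.
have : 1 <= `|n%:~R - (nearest y)%:~R| :> R.
  by rewrite -intrB -intr_norm ler1z -gtz0_ge1 normr_gt0 subr_eq0.
have := ler_normB (y - (nearest y)%:~R) (y - n%:~R).
have -> : y - (nearest y)%:~R - (y - n%:~R) = n%:~R - (nearest y)%:~R by ring.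
lra.
Qed.

(** [nearest y] is indeed a nearest integer.  The other properties of [ndist]
    follow from this minimality rather than from the floor function. *)
Lemma ndist_min y n : ndist y <= `|y - n%:~R|.
Proof.
have [->//|nm] := eqVneq n (nearest y).
exact: le_trans (ndist_le_half y) (ndist_away _ _ nm).
Qed.

Lemma ndist_lip y z : `|ndist y - ndist z| <= `|y - z|.
Proof.
have key u v : ndist u - ndist v <= `|u - v|.
  have := ndist_min u (nearest v).
  have := ler_normD (u - v) (v - (nearest v)%:~R).
  rewrite addrA subrK /ndist; lra.
have := key y z; have := key z y; rewrite (distrC z y) ler_norml; lra.
Qed.

Lemma ndist_ge y : Num.min `|y| (1 - `|y|) <= ndist y.
Proof.
rewrite /ndist ge_min; apply/orP.
have [->|n0] := eqVneq (nearest y) 0; [left|right]; first by rewrite subr0.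
have : 1 <= `|(nearest y)%:~R| :> R by rewrite -intr_norm ler1z -gtz0_ge1 normr_gt0.
have := ler_normB y (y - (nearest y)%:~R); rewrite subKr; lra.
Qed.

Lemma ndist_small y : `|y| <= 2^-1 -> ndist y = `|y|.
Proof.
move=> y2; apply/eqP; rewrite eq_le; apply/andP; split.
  by have := ndist_min y 0; rewrite subr0.
by have := ndist_ge y; rewrite min_l//; lra.
Qed.

Lemma ndistDz y n : ndist (y + n%:~R) = ndist y.
Proof.
have key u (k : int) : ndist (u + k%:~R) <= ndist u.
  have := ndist_min (u + k%:~R) (nearest u + k).
  by rewrite intrD opprD addrACA subrr addr0.
apply/eqP; rewrite eq_le key/=.
by have := key (y + n%:~R) (- n); rewrite mulrNz addrK.
Qed.

Lemma ndistN y : ndist (- y) = ndist y.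
Proof.
have key u : ndist (- u) <= ndist u.
  have := ndist_min (- u) (- nearest u).
  by rewrite mulrNz -opprD normrN.
apply/eqP; rewrite eq_le key/=.
by have := key (- y); rewrite opprK.
Qed.

Lemma ndist_continuous : continuous ndist.
Proof.
move=> y; apply/cvgrPdist_lt => e e0.
near=> z; apply: le_lt_trans (ndist_lip _ _) _.
by near: z; apply: cvgr_dist_lt.
Unshelve. all: by end_near. Qed.

Lemma measurable_ndist : measurable_fun [set: R] ndist.
Proof. by apply: continuous_measurable_fun; exact: ndist_continuous. Qed.

Definition tri w y : R := Num.max 0 (1 - ndist y / w).

Lemma tri_ge0 w y : 0 <= tri w y.
Proof. by rewrite le_max lexx. Qed.

Lemma tri_le1 w y : 0 < w -> tri w y <= 1.
Proof. by move=> w0; rewrite ge_max ler01/= lerBlDr lerDl divr_ge0 ?ndist_ge0// ltW. Qed.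

Lemma tri0 w : tri w 0 = 1.
Proof. by rewrite /tri ndist_small normr0 ?invr_ge0// mul0r subr0 max_r. Qed.

Lemma triDz w y n : tri w (y + n%:~R) = tri w y.
Proof. by rewrite /tri ndistDz. Qed.

Lemma triN w y : tri w (- y) = tri w y.
Proof. by rewrite /tri ndistN. Qed.

Lemma le_tri w1 w2 y : 0 < w1 -> w1 <= w2 -> tri w1 y <= tri w2 y.
Proof.
move=> w0 w12; rewrite ge_max tri_ge0/= /tri le_max; apply/orP; right.
rewrite lerD2l lerN2 ler_wpM2l ?ndist_ge0// lef_pV2 ?posrE//.
exact: lt_le_trans w12.
Qed.

Lemma tri_lip w y z : 0 < w -> `|tri w y - tri w z| <= `|y - z| / w.
Proof.
move=> w0; have key u v : tri w u - tri w v <= `|u - v| / w.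
  have : ndist v / w - ndist u / w <= `|u - v| / w.
    rewrite -mulrBl ler_pM2r ?invr_gt0//.
    by rewrite (le_trans (ler_norm _))// (le_trans (ndist_lip _ _))// distrC.
  have : 0 <= `|u - v| / w by rewrite divr_ge0// ltW.
  by rewrite /tri; case: (leP 0 (1 - ndist u / w)); case: (leP 0 (1 - ndist v / w)); lra.
have := key y z; have := key z y; rewrite (distrC z y) ler_norml; lra.
Qed.

Lemma bmeas_tri w : 0 < w -> bmeas R (tri w).
Proof.
move=> w0; split; last by exists 1 => y; rewrite ger0_norm ?tri_ge0// tri_le1.
apply: measurable_maxr; first exact: measurable_cst.
apply: measurable_funB; first exact: measurable_cst.
by apply: measurable_funM => //; exact: measurable_ndist.
Qed.

(** The two halves of the triangle fit together: [tri w x + tri w (x - w) = 1] for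
    [0 <= x <= w], so a translation by [w] replaces any explicit
    antiderivative. *)
Lemma segint_tri w y : 0 < w -> w <= 2^-1 -> segint R y (y + 1) (tri w) = w.
Proof.
move=> w0 w2; have bt := bmeas_tri _ w0.
rewrite segint_period//; last exact: triDz.
rewrite -(@segint_period _ (- w))//; last exact: triDz.
rewrite (@segint_cat _ _ 0)//; [|lra|lra].
rewrite (@segint_cat _ 0 w)//; [|lra|lra].
have -> : segint R w (- w + 1) (tri w) = 0.
  rewrite (@eq_segint _ _ _ _ (fun=> 0)) => [|x /andP[wx xw]].
    by rewrite segint_cst ?mul0r//; lra.
  rewrite /tri max_l// subr_le0 ler_pdivlMr// mul1r.
  have [x2|x2] := leP x 2^-1; first by rewrite ndist_small ger0_norm; lra.
  rewrite -(ndistDz _ (-1)) ndist_small ler0_norm; lra.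
have -> : segint R (- w) 0 (tri w) = segint R 0 w (fun x => tri w (x + - w)).
  by rewrite segint_shift// add0r subrr.
rewrite addr0 -segintD//; last exact: bmeas_shift.
rewrite (@eq_segint _ _ _ _ (fun=> 1)) => [|x /andP[x0 xw]].
  by rewrite segint_cst ?ltW// mul1r subr0.
have nx : ndist x = x by rewrite ndist_small ger0_norm//; lra.
have nxw : ndist (x + - w) = - (x - w) by rewrite ndist_small ler0_norm; lra.
rewrite /tri nx nxw.
have e1 : 0 <= x / w <= 1.
  by apply/andP; split; [exact/divr_ge0/ltW | rewrite ler_pdivrMr// mul1r].
have -> : - (x - w) / w = 1 - x / w by field; rewrite gt_eqF.
by rewrite !max_r; lra.
Qed.

End NearestInteger.

(** * The number variance as a pair sum *)

Section NumberVariance.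
Context (R : realType).
Implicit Types (x y z w : R) (n : int).

Definition box w y : R := (ndist R y <= w / 2)%R%:R.

Lemma boxDz w y n : box w (y + n%:~R) = box w y.
Proof. by rewrite /box ndistDz. Qed.

Lemma boxN w y : box w (- y) = box w y.
Proof. by rewrite /box ndistN. Qed.

Lemma bmeas_box w : bmeas R (box w).
Proof.
split; last by exists 1 => x; rewrite normr_nat lern1 leq_b1.
have -> : box w = \1_(ndist R @^-1` `]-oo, w / 2]).
  by apply/funext => y; rewrite indicE /box; congr (nat_of_bool _)%:R; apply/idP/idP; rewrite inE/= in_itv.
apply: measurable_indic; rewrite -[X in measurable X]setTI.
exact: measurable_ndist.
Qed.

(** For [w < 1] the only integer that can contribute is the one nearest to
    [- y], since all others keep [y + n] at distance at least 1/2 from 0. *)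
Lemma sum_chi_box w y : 0 < w < 1 ->
  \sum_(n \in [set: int]) chi ((y + n%:~R) / w) = box w y.
Proof.
move=> /andP[w0 w1].
have chiE n : chi ((y + n%:~R) / w) = (`|y + n%:~R| <= w / 2)%R%:R.
  rewrite /chi indicE mem_setE in_itv/= -ler_norml normrM normfV (gtr0_norm w0).
  by rewrite ler_pdivrMr// mulrC.
rewrite -(@fsbig_widen _ _ _ _ [set - nearest R y])//.
  by rewrite fsbig_set1 chiE mulrNz.
move=> n [_ /= ny]; rewrite chiE.
have : 2^-1 <= `|y - (- n)%:~R|.
  by apply: ndist_away; apply/eqP => nE; apply: ny; rewrite -nE opprK.
by rewrite mulrNz opprK => yn2; rewrite leNgt (lt_le_trans _ yn2)//; lra.
Qed.

Lemma segint_indic p q A B : p <= A -> B <= q ->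
  segint R p q (fun x => (A <= x <= B)%R%:R) = Num.max 0 (B - A).
Proof.
move=> pA Bq; rewrite /segint /Rintegral.
have -> : (fun x : R => ((A <= x <= B)%R%:R)%:E) = (fun x => (\1_`[A, B] x)%:E) :> (R -> \bar R).
  by apply/funext => x; rewrite indicE mem_setE in_itv.
rewrite integral_indic// setIidl; last first.
  by move=> x /=; rewrite !in_itv/= => /andP[Ax xB]; rewrite (le_trans pA)//= (le_trans xB).
transitivity (fine (@lebesgue_measure R [set` `[A, B]])) => //.
rewrite lebesgue_measure_itv/= lte_fin.
by case: ltP => AB/=; [rewrite max_r// subr_ge0 ltW | rewrite max_l// subr_le0].
Qed.

(** On the period centred at [y], the first factor restricts [x] to
    [|x - y| <= w / 2], and there the second one is the indicator of a single
    interval, centred at the representative of [z] closest to [y].  For this the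
    condition [w < 1/2] is essential: otherwise two arcs could meet at both
    ends. *)
Lemma segint_box2 w y z : 0 < w < 2^-1 ->
  segint R 0 1 (fun x => box w (y - x) * box w (z - x)) = w * tri R w (y - z).
Proof.
move=> /andP[w0 w2].
have bN u : bmeas R (fun x => box w (u - x)).
  have -> : (fun x => box w (u - x)) = (fun x => box w (x + - u)).
    by apply/funext => x; rewrite -boxN opprB.
  exact/bmeas_shift/bmeas_box.
rewrite -(@segint_period _ (y - 2^-1)); [|exact: bmeasM|]; last first.
  by move=> x n; rewrite !opprD !addrA -!mulrNz !boxDz.
set m := nearest R (z - y); set d := z - y - m%:~R.
have nd : ndist R (y - z) = `|d| by rewrite -ndistN opprB.
have d2 : `|d| <= 2^-1 := ndist_le_half R (z - y).
rewrite (@eq_segint _ _ _ _ (fun x =>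
   (Num.max (y - w / 2) (y + d - w / 2) <= x <= Num.min (y + w / 2) (y + d + w / 2))%R%:R)); last first.
  move=> x xy; rewrite ge_max le_min.
  have -> : box w (z - x) = box w (d + (y - x)).
    by rewrite -(boxDz _ (d + (y - x)) m); congr box; rewrite /d; ring.
  rewrite /box (@ndist_small _ (y - x)); last by rewrite ler_norml; lra.
  have [yx|yx] := leP `|y - x| (w / 2); last first.
    rewrite mul0r; move: yx; rewrite real_ltNge ?num_real// ler_norml => /negbTE yx.
    case: (boolP (_ && _)) => // H.
    by have : - (w / 2) <= y - x <= w / 2; [lra | rewrite yx].
  (* |d + (y - x)| stays below 1 - w / 2, so no other integer comes within w / 2. *)
  have nE : (ndist R (d + (y - x)) <= w / 2) = (`|d + (y - x)| <= w / 2).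
    have [h|h] := leP `|d + (y - x)| 2^-1; first by rewrite ndist_small.
    rewrite [RHS]leNgt (lt_trans _ h)/=; last lra.
    apply/negbTE; rewrite -ltNge.
    apply: lt_le_trans (ndist_ge _ _).
    have := ler_normD d (y - x); rewrite lt_min; lra.
  rewrite mul1r nE; congr (_%:R); congr nat_of_bool.
  move: yx; rewrite !ler_norml => yx; apply/idP/idP => H; lra.
rewrite segint_indic; last 2 first.
- by rewrite le_max; lra.
- by rewrite ge_min; lra.
have -> : tri R w (y - z) = Num.max 0 ((w - `|d|) / w).
  by rewrite /tri nd mulrBl divff// gt_eqF.
rewrite maxr_pMr ?ltW// mulr0 mulrCA divff ?gt_eqF// mulr1; congr Num.max.
have [d0|d0] := leP 0 d.
  by rewrite ger0_norm// max_r ?min_l; lra.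
by rewrite ltr0_norm// max_l ?min_r; lra.
Qed.

Lemma sum_symmetric (N : nat) (g : nat -> nat -> R) : (forall j k, g j k = g k j) ->
  \sum_(j < N) \sum_(k < N) g j k =
  \sum_(j < N) g j j + 2 * \sum_(j < N) \sum_(k < j) g j k.
Proof.
move=> gC; elim: N => [|N IH]; first by rewrite !big_ord0 mulr0 addr0.
rewrite !big_ord_recr/=.
under eq_bigr do rewrite big_ord_recr/=.
rewrite big_split/= IH; under [X in _ + X + _]eq_bigr do rewrite gC.
by ring.
Qed.

Definition paircount (a : nat -> R) (N : nat) (w alpha : R) : R :=
  \sum_(j < N) \sum_(k < j) tri R w (alpha * (a j.+1 - a k.+1)).

(** Expansion of the square: the diagonal pairs give [L], the cross term with the
    mean gives [- L^2], and each unordered pair [k < j] is counted twice. *)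
Lemma Sigma2E (a : nat -> R) (N : nat) (l alpha : R) :
  (0 < N)%N -> 0 < l / N%:R < 2^-1 ->
  Sigma2 a N l alpha = l - l ^+ 2 + 2 * (l / N%:R) * paircount a N (l / N%:R) alpha.
Proof.
move=> N0 /[dup] w02 /andP[w0 w2]; set w := l / N%:R in w02 w0 w2 *.
have Nw : N%:R * w = l by rewrite mulrC divfK// pnatr_eq0 -lt0n.
have bb u : bmeas R (fun x => box w (u - x)).
  have -> : (fun x => box w (u - x)) = (fun x => box w (x + - u)).
    by apply/funext => x; rewrite -boxN opprB.
  exact/bmeas_shift/bmeas_box.
have SE x : S_N a N l alpha x = \sum_(j < N) box w (alpha * a j.+1 - x).
  rewrite /S_N big_add1 big_mkord; apply: eq_bigr => j _.
  by rewrite -/w sum_chi_box// w0/=; lra.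
have box_int u : segint R 0 1 (fun x => box w (u - x)) = w.
  rewrite (@eq_segint _ _ _ _ (fun x => box w (u - x) * box w (u - x))).
    by rewrite segint_box2// subrr tri0 mulr1.
  by move=> x _; rewrite /box; case: (_ <= _); rewrite ?mulr1 ?mulr0.
transitivity (segint R 0 1 (fun x =>
    \sum_(j < N) \sum_(k < N) (box w (alpha * a j.+1 - x) * box w (alpha * a k.+1 - x))
    - (2 * l) * \sum_(j < N) box w (alpha * a j.+1 - x) + l ^+ 2)).
  apply: eq_Rintegral => x _; rewrite SE -big_distrlr/=; ring.
have bs : bmeas R (fun x => \sum_(j < N) box w (alpha * a j.+1 - x)) by exact: bmeas_sum.
have bss (j : 'I_N) : bmeas R (fun x =>
    \sum_(k < N) (box w (alpha * a j.+1 - x) * box w (alpha * a k.+1 - x))).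
  by apply: bmeas_sum => k; exact: bmeasM.
rewrite segintD; [|apply: bmeasB; [exact: bmeas_sum|exact: bmeasZ]|exact: bmeas_cst].
rewrite segintB; [|exact: bmeas_sum|exact: bmeasZ].
rewrite segintZ// segint_cst// segint_sum//.
under eq_bigr => j _.
  rewrite segint_sum; last by move=> k; exact: bmeasM.
  under eq_bigr => k _ do rewrite segint_box2// -mulrBr.
  rewrite -mulr_sumr; over.
rewrite -mulr_sumr segint_sum//.
have -> : \sum_(j < N) segint R 0 1 (fun x => box w (alpha * a j.+1 - x)) = l.
  rewrite (eq_bigr (fun=> w)) => [|j _]; last exact: box_int.
  by rewrite sumr_const card_ord -[w *+ N]mulr_natl Nw.
rewrite (sum_symmetric N (fun j k => tri R w (alpha * (a j.+1 - a k.+1)))); last first.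
  by move=> j k; rewrite -triN -mulrN opprB.
have -> : \sum_(j < N) tri R w (alpha * (a j.+1 - a j.+1)) = N%:R.
  rewrite (eq_bigr (fun=> 1)) => [|j _]; last by rewrite subrr mulr0 tri0.
  by rewrite sumr_const card_ord.
rewrite -/(paircount _ _ _ _) -Nw; ring.
Qed.

Lemma paircount_ge0 a N w alpha : 0 <= paircount a N w alpha.
Proof. by apply: sumr_ge0 => j _; apply: sumr_ge0 => k _; exact: tri_ge0. Qed.

(** This monotonicity is what allows the passage from the squares to all [N]. *)
Lemma le_paircount a (N N' : nat) w w' alpha : (N <= N')%N -> 0 < w -> w <= w' ->
  paircount a N w alpha <= paircount a N' w' alpha.
Proof.
move=> NN w0 ww; apply: (@le_trans _ _ (paircount a N w' alpha)).
  by apply: ler_sum => j _; apply: ler_sum => k _; exact: le_tri.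
rewrite /paircount -(big_mkord xpredT (fun j => \sum_(k < j) tri R w' (alpha * (a j.+1 - a k.+1)))).
rewrite -(big_mkord xpredT (fun j => \sum_(k < j) tri R w' (alpha * (a j.+1 - a k.+1)))).
rewrite (big_cat_nat (leq0n N) NN)/= lerDl; apply: sumr_ge0 => j _.
by apply: sumr_ge0 => k _; exact: tri_ge0.
Qed.

End NumberVariance.

(** * Decorrelation by shifting the variable *)

Section Decorrelation.
Context (R : realType).
Implicit Types (x y z w s t b c tau theta : R).

Lemma segint_shift_close s t tau (h : R -> R) : s <= t -> 0 <= tau ->
  bmeas R h -> (forall x, `|h x| <= 1) ->
  `|segint R s t h - segint R s t (fun x => h (x + tau))| <= 2 * tau.
Proof.
move=> st tau0 bh h1; rewrite segint_shift//.
have e : segint R s t h + segint R t (t + tau) h =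
         segint R s (s + tau) h + segint R (s + tau) (t + tau) h.
  by rewrite -!segint_cat//; lra.
have p1 : `|segint R t (t + tau) h| <= tau.
  have := @segint_normM R t (t + tau) h 1; rewrite mul1r addrAC subrr add0r; apply => //; lra.
have p2 : `|segint R s (s + tau) h| <= tau.
  have := @segint_normM R s (s + tau) h 1; rewrite mul1r addrAC subrr add0r; apply => //; lra.
move: p1 p2; rewrite !ler_norml; lra.
Qed.

Lemma ler_norm_sum_ord (n : nat) (F : 'I_n -> R) (M : R) :
  (forall i, `|F i| <= M) -> `|\sum_(i < n) F i| <= n%:R * M.
Proof.
move=> FM; apply: (le_trans (ler_norm_sum _ _ _)).
apply: (@le_trans _ _ (\sum_(i < n) M)); first exact: ler_sum.
by rewrite sumr_const card_ord mulr_natl.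
Qed.

(** The integral of [u * v] changes little when the variable is shifted by
    [l * tau], and averaging over [l < n] kills [v] without moving [u]. *)
Lemma shift_decorrelation s t tau (n : nat) (u v : R -> R) (d1 d2 : R) :
  s <= t -> 0 <= tau -> (0 < n)%N -> bmeas R u -> bmeas R v ->
  (forall x, `|u x| <= 1) -> (forall x, `|v x| <= 1) ->
  (forall x (l : 'I_n), `|u (x + l%:R * tau) - u x| <= d1) ->
  (forall x, `|\sum_(l < n) v (x + l%:R * tau)| <= n%:R * d2) ->
  `|segint R s t (fun x => u x * v x)| <= (d1 + d2) * (t - s) + 2 * n%:R * tau.
Proof.
move=> st tau0 n0 bu bv u1 v1 ud vd.
have nR : 0 < n%:R :> R by rewrite ltr0n.
pose h x := u x * v x.
have bh : bmeas R h by exact: bmeasM.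
have h1 x : `|h x| <= 1 by rewrite normrM mulr_ile1.
rewrite -(ler_pM2l nR) -{1}(gtr0_norm nR) -normrM.
have -> : n%:R * segint R s t h =
  \sum_(l < n) (segint R s t h - segint R s t (fun x => h (x + l%:R * tau)))
  + segint R s t (fun x => \sum_(l < n) h (x + l%:R * tau)).
  rewrite sumrB sumr_const card_ord mulr_natl segint_sum ?subrK// => l.
  exact: bmeas_shift.
rewrite mulrDr addrC (le_trans (ler_normD _ _))// lerD//.
  rewrite mulrA; apply: segint_normM => //.
    by apply: bmeas_sum => l; exact: bmeas_shift.
  move=> x; rewrite [X in `|X|](_ : _ =
     \sum_(l < n) ((u (x + l%:R * tau) - u x) * v (x + l%:R * tau)) +
     u x * \sum_(l < n) v (x + l%:R * tau)); last first.
    rewrite mulr_sumr -big_split/=; apply: eq_bigr => l _; rewrite /h; ring.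
  rewrite mulrDr (le_trans (ler_normD _ _))// lerD//; last first.
    by rewrite normrM (le_trans _ (vd x))// ler_piMl.
  apply: ler_norm_sum_ord => l; rewrite normrM (le_trans _ (ud x l))//.
  by rewrite ler_piMr.
apply: ler_norm_sum_ord => l.
apply: (le_trans (segint_shift_close _ _ _ _ _ _ _ _)) => //; first exact: mulr_ge0.
by rewrite mulrA ler_wpM2r// ler_pM2l// ler_nat ltnW.
Qed.

(** Riemann sums with step [theta] approximate the integral over one period,
    which vanishes.  The number of steps is the integer part of [1 / theta], so
    an incomplete last step has to be accounted for, at the cost of the [2]. *)
Lemma riemann_sum_meanzero (f : R -> R) (Lam : R) y theta (n : nat) :
  bmeas R f -> (forall x, `|f x| <= 1) ->
  (forall x z, `|f x - f z| <= Lam * `|x - z|) ->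
  segint R y (y + 1) f = 0 ->
  (0 < n)%N -> 0 < theta -> n%:R * theta <= 1 < n%:R * theta + theta ->
  `|\sum_(l < n) f (y + l%:R * theta)| <= n%:R * ((Lam + 2) * theta).
Proof.
move=> bf f1 flip f0 n0 th0 /andP[nth1 nth2].
have cut m : segint R y (y + m%:R * theta) f =
   \sum_(l < m) segint R (y + l%:R * theta) (y + l.+1%:R * theta) f.
  elim: m => [|m IH].
    rewrite big_ord0 mul0r addr0; have := @segint_normM R y y f 1.
    by rewrite subrr mulr0 normr_le0 => /(_ (lexx _) bf (fun x _ => f1 x))/eqP.
  rewrite big_ord_recr/= -IH (@segint_cat _ _ (y + m%:R * theta))//.
    by rewrite lerDl mulr_ge0// ltW.
  by rewrite lerD2l ler_wpM2r ?ler_nat// ltW.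
have Lam0 : 0 <= Lam by have := flip 1 0; rewrite subr0 normr1 mulr1; exact: le_trans.
have cell (l : 'I_n) : `|theta * f (y + l%:R * theta) -
    segint R (y + l%:R * theta) (y + l.+1%:R * theta) f| <= Lam * theta * theta.
  set p := y + l%:R * theta.
  have -> : y + l.+1%:R * theta = p + theta by rewrite /p -natr1 mulrDl mul1r addrA.
  have pp : p <= p + theta by lra.
  have -> : theta * f p = segint R p (p + theta) (fun=> f p).
    by rewrite segint_cst// addrAC subrr add0r mulrC.
  rewrite -segintB//; last exact: bmeas_cst.
  (* On a cell of length theta the function moves by at most Lam * theta. *)
  rewrite [X in _ <= _ * X](_ : theta = p + theta - p); last by rewrite addrAC subrr add0r.
  apply: segint_normM => //; first by apply: bmeasB => //; exact: bmeas_cst.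
  move=> x /andP[px xp]; apply: (le_trans (flip _ _)); rewrite ler_wpM2l//.
  by rewrite distrC ger0_norm ?subr_ge0//; lra.
have rest : `|segint R (y + n%:R * theta) (y + 1) f| <= theta.
  have h : y + n%:R * theta <= y + 1 by rewrite lerD2l.
  by apply: (le_trans (@segint_normM R _ _ f 1 h bf (fun x _ => f1 x))); lra.
have : segint R (y + n%:R * theta) (y + 1) f = - segint R y (y + n%:R * theta) f.
  apply/eqP; rewrite -addr_eq0 addrC -segint_cat ?f0// ?lerD2l//.
  by rewrite lerDl mulr_ge0// ltW.
rewrite cut => restE.
have : `|\sum_(l < n) (theta * f (y + l%:R * theta) -
    segint R (y + l%:R * theta) (y + l.+1%:R * theta) f)| <= n%:R * (Lam * theta * theta).
  exact: ler_norm_sum_ord.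
rewrite sumrB -mulr_sumr => cells.
have n1 : 1 <= n%:R :> R by rewrite ler1n.
rewrite -(ler_pM2l th0) -{1}(gtr0_norm th0) -normrM.
have -> : theta * (n%:R * ((Lam + 2) * theta)) =
  n%:R * (Lam * theta * theta) + 2 * (n%:R * theta) * theta by ring.
have th1 : theta <= n%:R * theta by rewrite ler_peMl// ltW.
have : theta <= 2 * (n%:R * theta) * theta by rewrite ler_peMl ?ltW//; lra.
move: rest cells; rewrite restE normrN !ler_norml; lra.
Qed.

Definition ctri w y : R := tri R w y - w.

Section CenteredTriangle.
Variable w : R.
Hypotheses (w0 : 0 < w) (w2 : w <= 2^-1).

Lemma bmeas_ctri : bmeas R (ctri w).
Proof. by apply: bmeasB; [exact: bmeas_tri | exact: bmeas_cst]. Qed.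

Lemma ctri_norm y : `|ctri w y| <= 1.
Proof.
have := tri_ge0 R w y; have := tri_le1 R w y w0; have := w2; have := w0.
rewrite /ctri ler_norml; lra.
Qed.

Lemma ctri_lip y z : `|ctri w y - ctri w z| <= w^-1 * `|y - z|.
Proof.
by rewrite /ctri opprB addrA subrK mulrC; exact: tri_lip.
Qed.

Lemma ctriDz y (n : int) : ctri w (y + n%:~R) = ctri w y.
Proof. by rewrite /ctri triDz. Qed.

Lemma segint_ctri y : segint R y (y + 1) (ctri w) = 0.
Proof.
rewrite segintB; [|exact: bmeas_tri|exact: bmeas_cst].
by rewrite segint_tri// segint_cst ?lerDl// [y + 1]addrC addrK mulr1 subrr.
Qed.

Lemma ctri_sum y theta (n : nat) :
  (0 < n)%N -> 0 < theta -> n%:R * theta <= 1 < n%:R * theta + theta ->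
  `|\sum_(l < n) ctri w (y + l%:R * theta)| <= n%:R * (2 / w * theta).
Proof.
move=> n0 th0 nth.
apply: (le_trans (@riemann_sum_meanzero _ _ y _ _ bmeas_ctri ctri_norm ctri_lip
  (segint_ctri y) n0 th0 nth)).
rewrite ler_wpM2l// ler_wpM2r//; first exact: ltW.
have : 2 <= w^-1 by rewrite -[2]invrK lef_pV2// posrE.
lra.
Qed.

(** The shifts run through one period [1 / b] of the fast factor, in at least
    [b] steps; over this range [u] moves by at most [Lam / b]. *)
Lemma ctri_decorrelates_slow s t b Lam (u : R -> R) : s <= t -> 0 < b ->
  bmeas R u -> (forall x, `|u x| <= 1) -> (forall x y, `|u x - u y| <= Lam * `|x - y|) ->
  `|segint R s t (fun x => u x * ctri w (x * b))| <=
  ((Lam + 2 / w) * (t - s) + 2) / b.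
Proof.
move=> st b0 bu u1 ulip.
have Lam0 : 0 <= Lam by have := ulip 1 0; rewrite subr0 normr1 mulr1; exact: le_trans.
(* Any n >= b would do; the Riemann error 2 / (w n) then has the size of 1 / (b w). *)
pose n := (Num.truncn b).+1.
have nb : b <= n%:R by rewrite ltW// truncnS_gt.
have nR : 0 < n%:R :> R by rewrite ltr0n.
pose tau := (b * n%:R)^-1.
have tau0 : 0 < tau by rewrite invr_gt0 mulr_gt0.
have ntau : n%:R * tau = b^-1 by rewrite /tau invfM mulrCA divff ?gt_eqF// mulr1.
have btau : tau * b = n%:R^-1 by rewrite /tau invfM mulrC mulrA divff ?gt_eqF// mul1r.
apply: (le_trans (@shift_decorrelation s t tau n u (fun x => ctri w (x * b))
  (Lam / b) (2 / w * n%:R^-1) st (ltW tau0) _ bu _ u1 _ _ _)) => //.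
- exact/bmeas_lincomp/bmeas_ctri.
- by move=> x; exact: ctri_norm.
- move=> x l; apply: (le_trans (ulip _ _)); rewrite ler_wpM2l//.
  have lt0 : 0 <= l%:R * tau by exact/mulr_ge0/ltW.
  by rewrite addrC addKr -ntau ger0_norm// ler_pM2r// ler_nat ltnW.
- move=> x; under eq_bigr do rewrite mulrDl -mulrA btau.
  by apply: ctri_sum; rewrite ?invr_gt0// divff ?gt_eqF// lexx/= ltrDl invr_gt0.
rewrite -[2 * n%:R * tau]mulrA ntau [leRHS]mulrDl lerD2r [leRHS]mulrAC ler_wpM2r ?subr_ge0//.
rewrite [leRHS]mulrDl lerD2l ler_pM2l ?divr_gt0//.
by rewrite lef_pV2 ?posrE.
Qed.

(** [|tri w - w| <= 2 w + ctri w] since [tri w] is nonnegative, and the mean of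
    [ctri w] is small by the case of a constant [u]. *)
Lemma ctri_mean_abs s t b (u : R -> R) : s <= t -> 0 < b ->
  bmeas R u -> (forall x, `|u x| <= 1) ->
  `|segint R s t (fun x => u x * ctri w (x * b))| <=
  2 * w * (t - s) + (2 / w * (t - s) + 2) / b.
Proof.
move=> st b0 bu u1.
have bf : bmeas R (fun x => ctri w (x * b)) by exact/bmeas_lincomp/bmeas_ctri.
apply: (le_trans (segint_norm _ _ _ _ (bmeasM _ _ _ bu bf))).
apply: (@le_trans _ _ (segint R s t (fun x => 2 * w + 1 * ctri w (x * b)))).
  apply: le_segint; [exact/bmeas_norm/bmeasM | | ].
    by apply: bmeasD; [exact: bmeas_cst | exact: bmeasZ].
  move=> x _; rewrite normrM mul1r.
  apply: (@le_trans _ _ `|ctri w (x * b)|); first by rewrite ler_piMl.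
  have := w0; have := tri_ge0 R w (x * b); rewrite /ctri ler_norml; lra.
rewrite segintD ?segint_cst//; [|exact: bmeas_cst|exact: bmeasZ].
rewrite lerD2l; apply: (le_trans (ler_norm _)).
have := @ctri_decorrelates_slow s t b 0 (fun=> 1) st b0; rewrite add0r; apply.
- exact: bmeas_cst.
- by move=> _; rewrite normr1.
- by move=> x y; rewrite subrr normr0 mul0r.
Qed.

(** A shift by [1 / b] does not change the first factor at all, while it moves
    the argument of the second one by [c / b] modulo 1; after about [b / c]
    shifts, that is after a time [1 / c], the second factor has run through a
    whole period. *)
Lemma ctri_decorrelates_shifted s t b c : s <= t -> 0 < c -> c <= b ->
  `|segint R s t (fun x => ctri w (x * b) * ctri w (x * (b + c)))| <=
  2 / w * (c / b) * (t - s) + 2 / c.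
Proof.
move=> st c0 cb; have b0 : 0 < b by exact: lt_le_trans cb.
pose n := Num.truncn (b / c).
have n0 : (0 < n)%N by rewrite truncn_gt0 ler_pdivlMr// mul1r.
have bc0 : 0 <= b / c by rewrite divr_ge0 ?ltW.
have th0 : 0 < c / b by rewrite divr_gt0.
have nbc : n%:R <= b / c by rewrite truncn_le.
have bcc : b / c * (c / b) = 1 by rewrite mulrA divfK ?gt_eqF// divff ?gt_eqF.
have bcc1 : n%:R * (c / b) <= 1 < n%:R * (c / b) + c / b.
  have e1 : n%:R * (c / b) <= b / c * (c / b) by rewrite ler_pM2r.
  have e2 : b / c * (c / b) < n.+1%:R * (c / b) by rewrite ltr_pM2r// truncnS_gt.
  by move: e1 e2; rewrite bcc -natr1 mulrDl mul1r => -> ->.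
apply: (le_trans (@shift_decorrelation s t b^-1 n (fun x => ctri w (x * b))
  (fun x => ctri w (x * (b + c))) 0 (2 / w * (c / b)) st _ n0 _ _ _ _ _ _)).
- by rewrite invr_ge0 ltW.
- exact/bmeas_lincomp/bmeas_ctri.
- exact/bmeas_lincomp/bmeas_ctri.
- by move=> x; exact: ctri_norm.
- by move=> x; exact: ctri_norm.
- move=> x l; rewrite mulrDl divfK ?gt_eqF//.
  by rewrite -[l%:R]/((l : int)%:~R) ctriDz subrr normr0.
- move=> x; have := @ctri_sum (x * (b + c)) (c / b) n n0 th0; rewrite bcc1 => /(_ isT).
  rewrite [X in `|X| <= _ -> _](eq_bigr (fun l : 'I_n => ctri w ((x + l%:R * b^-1) * (b + c)))) => //.
  move=> l _; rewrite -[RHS](ctriDz _ (- (l : nat)%:Z)); congr ctri.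
  by rewrite mulrNz -[(l%:Z)%:~R]/(l%:R); field; rewrite gt_eqF.
rewrite add0r lerD2l -mulrA ler_pM2l// ler_pdivrMr//.
by rewrite mulrC.
Qed.
End CenteredTriangle.

End Decorrelation.

(** * Mean square of the fluctuation for a lacunary sequence *)

Lemma count_window (N m l : nat) : (\sum_(i < N) (m <= i < m + l) <= l)%N.
Proof.
elim: l => [|l IH]; first by rewrite big1// => i _; rewrite addn0; case: ltngtP.
apply: (@leq_trans (\sum_(i < N) ((m <= i < m + l) + (i == (m + l)%N :> nat)))%N).
  by apply: leq_sum => i _; lia.
rewrite big_split/= -[leqRHS]addn1 leq_add//.
have [h|h] := ltnP (m + l) N; last first.
  by rewrite big1// => i _; apply/eqP; rewrite eqb0; have := ltn_ord i; lia.
rewrite (bigD1 (Ordinal h))//= eqxx big1// => i.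
by rewrite -val_eqE/= => /negbTE ->.
Qed.

Section VarianceBound.
Context (R : realType).
Variables (C : R) (A : nat -> R).
Hypotheses (C1 : 1 < C) (A0 : 0 < A 0%N) (AC : forall n, C * A n <= A n.+1).

Let q D : R := C^-1 ^+ D.
Let kap : R := 1 - C^-1.

Lemma lacunary_gap i D : A i <= q D * A (i + D)%N.
Proof.
have C0 : 0 < C by exact: lt_trans C1.
elim: D => [|D IH]; first by rewrite /q expr0 mul1r addn0.
apply: (le_trans IH); rewrite /q exprSr -mulrA ler_pM2l ?exprn_gt0 ?invr_gt0//.
by rewrite ler_pdivlMl// addnS.
Qed.

Lemma lacunary_gt0 i : 0 < A i.
Proof.
have C0 : 0 < C by exact: lt_trans C1.
by elim: i => // i IH; apply: lt_le_trans (AC i); exact: mulr_gt0.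
Qed.

Lemma lacunary_le i j : (i <= j)%N -> A i <= A j.
Proof.
have C0 : 0 < C by exact: lt_trans C1.
move=> /subnKC <-; elim: (j - i)%N => [|n IH]; first by rewrite addn0.
apply: (le_trans IH); rewrite addnS; apply: le_trans (AC _).
by rewrite ler_peMl ?ltW// lacunary_gt0.
Qed.

Lemma lacunary_gap_le i j D : (i + D <= j)%N -> A i <= q D * A j.
Proof.
have C0 : 0 < C by exact: lt_trans C1.
move=> ij; apply: (le_trans (lacunary_gap i D)).
by rewrite ler_pM2l ?exprn_gt0 ?invr_gt0//; exact: lacunary_le.
Qed.

Lemma kap_gt0 : 0 < kap.
Proof. by rewrite subr_gt0 invf_lt1// (lt_trans _ C1). Qed.

(** Every difference of frequencies is comparable to the larger frequency. *)
Lemma lacunary_diff k j : (k < j)%N -> kap * A j <= A j - A k.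
Proof.
move=> kj; have := @lacunary_gap_le k j 1; rewrite addn1 /q expr1 => /(_ kj).
rewrite /kap; lra.
Qed.

Lemma lacunary_diff_inv k j D : (k < j)%N -> (D <= j)%N ->
  (A j - A k)^-1 <= q D / (kap * A 0%N).
Proof.
move=> kj Dj; have C0 : 0 < C by exact: lt_trans C1.
have q0 : 0 < q D by rewrite exprn_gt0 ?invr_gt0.
have K0 := kap_gt0.
have h : kap * A 0%N / q D <= A j - A k.
  apply: le_trans (lacunary_diff _ _ kj); rewrite -mulrA ler_pM2l//.
  by rewrite ler_pdivrMr// mulrC; exact: lacunary_gap_le.
rewrite -[leRHS]invrK invf_div lef_pV2// posrE; last by rewrite divr_gt0// mulr_gt0.
by apply: lt_le_trans h; rewrite divr_gt0// mulr_gt0.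
Qed.

Lemma lacunary_ratio i k j D : (i + D <= j)%N -> (k < j)%N ->
  A i / (A j - A k) <= q D / kap.
Proof.
move=> ij kj; have K0 := kap_gt0; have Aj := lacunary_gt0 j.
have d0 : 0 < A j - A k.
  by apply: lt_le_trans (lacunary_diff _ _ kj); rewrite mulr_gt0.
have q0 : 0 < q D by rewrite exprn_gt0 ?invr_gt0// (lt_trans _ C1).
rewrite ler_pdivrMr// (le_trans (lacunary_gap_le _ _ _ ij))//.
by rewrite -mulrA ler_pM2l// ler_pdivlMl// lacunary_diff.
Qed.

Variables (s t w : R) (D : nat).
Hypotheses (st : s <= t) (w0 : 0 < w) (w2 : w <= 2^-1) (D0 : (0 < D)%N).

Let T := t - s.
Let K : R := 2 * T / kap + (2 * T + 2) / (kap * A 0%N).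
Let sig : R := K * q D / w.
Let f j k x : R := ctri R w (x * (A j - A k)).
Let J j k j' k' := segint R s t (fun x => f j k x * f j' k' x).

Let T0 : 0 <= T. Proof. by rewrite subr_ge0. Qed.
Let q0 : 0 < q D. Proof. by rewrite exprn_gt0 ?invr_gt0// (lt_trans _ C1). Qed.
Let bf j k : bmeas R (f j k). Proof. exact/bmeas_lincomp/bmeas_ctri. Qed.
Let f1 j k x : `|f j k x| <= 1. Proof. exact: ctri_norm. Qed.
Let JC j k j' k' : J j k j' k' = J j' k' j k.
Proof. by apply: eq_segint => x _; rewrite mulrC. Qed.
Let diff_gt0 k j : (k < j)%N -> 0 < A j - A k.
Proof.
move=> kj; apply: lt_le_trans (lacunary_diff _ _ kj).
by rewrite mulr_gt0 ?kap_gt0// lacunary_gt0.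
Qed.

Let sig_ge0 : 0 <= sig.
Proof.
apply: divr_ge0; last exact: ltW.
apply: mulr_ge0; last exact: ltW.
have K0 := kap_gt0; have T0' := T0.
apply: addr_ge0; apply: divr_ge0; [lra|exact: ltW|lra|].
by apply/ltW/mulr_gt0.
Qed.

(** The higher frequency exceeds the lower one by a factor of order [C^D], so the
    lower one plays the role of the slow factor. *)
Lemma far_covariance j k j' k' : (k < j)%N -> (k' < j')%N -> (j' + D <= j)%N ->
  `|J j k j' k'| <= sig.
Proof.
move=> kj kj' jj; set b := A j - A k; set b' := A j' - A k'.
have b0 : 0 < b by exact: diff_gt0.
have b'0 : 0 < b' by exact: diff_gt0.
have b'A : b' <= A j' by rewrite lerBlDr lerDl ltW// lacunary_gt0.
rewrite JC; apply: (le_trans (@ctri_decorrelates_slow _ _ w0 w2 s t b (b' / w) (f j' k') st b0 _ _ _)) => //.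
  move=> x y; apply: (le_trans (ctri_lip _ _ w0 _ _)).
  by rewrite -mulrBl normrM (gtr0_norm b'0) le_eqVlt; apply/orP; left; apply/eqP; ring.
have r1 : b' / b <= q D / kap.
  apply: le_trans (lacunary_ratio _ _ _ _ jj kj).
  by rewrite ler_pM2r// invr_gt0.
have Dj : (D <= j)%N by apply: leq_trans jj; rewrite leq_addl.
have r2 : b^-1 <= q D / (kap * A 0%N) by exact: lacunary_diff_inv.
have -> : ((b' / w + 2 / w) * (t - s) + 2) / b =
    w^-1 * (T * (b' / b) + (2 * T + 2 * w) * b^-1).
  by rewrite -/T; field; rewrite !gt_eqF.
have -> : sig = w^-1 * (2 * T * (q D / kap) + (2 * T + 2) * (q D / (kap * A 0%N))).
  rewrite /sig /K; field; rewrite !gt_eqF ?kap_gt0//.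
rewrite ler_pM2l ?invr_gt0// lerD//.
  have : 0 <= q D / kap by rewrite divr_ge0// ltW// kap_gt0.
  have := T0; nra.
have T0' := T0; have w0' := w0; have w2' := w2.
by apply: ler_pM => //; [lra|rewrite invr_ge0 ltW|lra].
Qed.

(** The trivial bound, of the size of the mean of [|ctri w|]; it is used for the
    few pairs of indices that are not well separated. *)
Lemma any_covariance j k (u : R -> R) : (k < j)%N -> (D <= j)%N ->
  bmeas R u -> (forall x, `|u x| <= 1) ->
  `|segint R s t (fun x => u x * f j k x)| <= 2 * w * T + sig.
Proof.
move=> kj Dj bu u1; set b := A j - A k.
have b0 : 0 < b by exact: diff_gt0.
apply: (le_trans (@ctri_mean_abs _ _ w0 w2 s t b u st b0 bu u1)); rewrite lerD2l.
have r2 : b^-1 <= q D / (kap * A 0%N) by apply: lacunary_diff_inv.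
have -> : (2 / w * (t - s) + 2) / b = w^-1 * ((2 * T + 2 * w) * b^-1).
  by rewrite -/T; field; rewrite !gt_eqF.
have -> : sig = w^-1 * (2 * T * (q D / kap) + (2 * T + 2) * (q D / (kap * A 0%N))).
  by rewrite /sig /K; field; rewrite !gt_eqF ?kap_gt0.
have T0' := T0; have w0' := w0; have w2' := w2.
rewrite ler_pM2l ?invr_gt0// -[leLHS]add0r lerD//.
  by apply: mulr_ge0; [lra | apply: divr_ge0; apply: ltW => //; exact: kap_gt0].
by apply: ler_pM => //; [lra|rewrite invr_ge0 ltW|lra].
Qed.

(** Two terms of the same [F_j]: their frequencies are close to each other, but
    their difference [A k - A k'] is large in absolute terms and small compared
    with [A j]. *)
Lemma near_covariance j k k' : (k' < k)%N -> (D <= k)%N -> (k + D <= j)%N ->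
  `|J j k j k'| <= sig.
Proof.
move=> kk Dk kj; have kj' : (k < j)%N by lia.
set b := A j - A k; set c := A k - A k'.
have b0 : 0 < b by exact: diff_gt0.
have c0 : 0 < c by exact: diff_gt0.
have K0 := kap_gt0; have T0' := T0; have w0' := w0; have w2' := w2.
have cA : c <= A k by rewrite lerBlDr lerDl ltW// lacunary_gt0.
have r1 : c / b <= q D / kap.
  apply: le_trans (lacunary_ratio _ _ _ _ kj kj').
  by rewrite ler_pM2r// invr_gt0.
have r2 : c^-1 <= q D / (kap * A 0%N) by exact: lacunary_diff_inv.
have sigE : sig = w^-1 * (2 * T * (q D / kap) + (2 * T + 2) * (q D / (kap * A 0%N))).
  by rewrite /sig /K; field; rewrite !gt_eqF.
have qk0 : 0 <= q D / kap by rewrite divr_ge0 ?ltW.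
have qk1 : 0 <= q D / (kap * A 0%N) by rewrite divr_ge0 ?ltW// mulr_gt0.
have w1 : 1 <= w^-1 by rewrite invf_ge1//; lra.
have [cb|cb] := leP c b.
  have bc : A j - A k' = b + c by rewrite /b /c; ring.
  rewrite /J /f bc.
  apply: (le_trans (@ctri_decorrelates_shifted _ _ w0 w2 s t b c st c0 cb)).
  have -> : 2 / w * (c / b) * (t - s) = w^-1 * (2 * T * (c / b)) by rewrite -/T; ring.
  rewrite sigE [leRHS]mulrDr lerD//.
    by rewrite ler_pM2l ?invr_gt0// ler_wpM2l// mulr_ge0.
  apply: (@le_trans _ _ (1 * ((2 * T + 2) * (q D / (kap * A 0%N))))).
    rewrite mul1r; apply: ler_pM => //; [by rewrite invr_ge0 ltW|lra].
  by rewrite ler_wpM2r// mulr_ge0//; lra.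
(* If c > b then D is so small that the bound exceeds the length of the segment. *)
have cb1 : 1 <= q D / kap by apply: le_trans r1; rewrite ler_pdivlMr// mul1r ltW.
apply: (@le_trans _ _ (1 * T)).
  apply: segint_normM => //; first exact: bmeasM.
  by move=> x _; rewrite normrM mulr_ile1.
rewrite mul1r sigE -[leLHS]mul1r; apply: ler_pM => //.
rewrite -[leLHS]addr0 lerD//; last by rewrite mulr_ge0//; lra.
nra.
Qed.

Let bad j k k' : nat :=
  (((0 <= k < 0 + D) + (j - D <= k < j - D + D)) +
   ((0 <= k' < 0 + D) + (j - D <= k' < j - D + D)) + (k == k'))%N.

Let square_term j k k' : (D <= j)%N -> (k < j)%N -> (k' < j)%N ->
  `|J j k j k'| <= sig + (bad j k k')%:R * (2 * w * T + sig).
Proof.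
move=> Dj kj kj'; set B := _ + sig.
have B0 : 0 <= B by rewrite addr_ge0// !mulr_ge0// ltW.
have [b0|] := posnP (bad j k k'); last first.
  move=> bpos; rewrite -[leLHS]add0r lerD//.
  apply: (@le_trans _ _ (1 * B)); last by rewrite ler_wpM2r// ler1n.
  by rewrite mul1r; exact: any_covariance.
rewrite b0 mul0r addr0.
have [kk|kk|kk] := ltngtP k k'.
- by rewrite JC; apply: near_covariance => //; move: b0; rewrite /bad; lia.
- by apply: near_covariance => //; move: b0; rewrite /bad; lia.
- by move: b0; rewrite /bad kk eqxx; lia.
Qed.

Let F j x := \sum_(k < j) f j k x.
Let bF j : bmeas R (F j). Proof. exact: bmeas_sum. Qed.

Let covE j j' : segint R s t (fun x => F j x * F j' x) =
  \sum_(k < j) \sum_(k' < j') J j k j' k'.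
Proof.
transitivity (segint R s t (fun x => \sum_(k < j) \sum_(k' < j') (f j k x * f j' k' x))).
  by apply: eq_segint => x _; rewrite big_distrlr.
rewrite segint_sum => [|k]; last by apply: bmeas_sum => k'; exact: bmeasM.
by apply: eq_bigr => k _; rewrite segint_sum// => k'; exact: bmeasM.
Qed.

(** The trivial bound is needed only if [k] or [k'] lies within [D] of 0 or of
    [j], or if [k = k'], hence for at most [5 D N] pairs.  The first term takes
    care of [j < D], where [|F_j| <= D]. *)
Lemma square_bound (N j : nat) : (j < N)%N ->
  segint R s t (fun x => F j x * F j x) <=
  T * D%:R ^+ 2 + N%:R ^+ 2 * sig + 5 * D%:R * N%:R * (2 * w * T + sig).
Proof.
move=> jN; set B := _ * _ + sig.
have B0 : 0 <= B by rewrite addr_ge0// !mulr_ge0// ltW.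
have T0' := T0; have sig0 := sig_ge0.
have [jD|Dj] := ltnP j D.
  apply: (@le_trans _ _ (T * D%:R ^+ 2)).
    apply: (le_trans (ler_norm _)); rewrite mulrC.
    apply: segint_normM => //; first exact: bmeasM.
    move=> x _; rewrite normrM -expr2 ler_pXn2r ?nnegrE//.
    apply: (@le_trans _ _ (j%:R * 1)); first exact: ler_norm_sum_ord.
    by rewrite mulr1 ler_nat ltnW.
  by rewrite -addrA lerDl addr_ge0// mulr_ge0// ?exprn_ge0// !mulr_ge0.
have S : segint R s t (fun x => F j x * F j x) <=
    \sum_(k < j) \sum_(k' < j) (sig + (bad j k k')%:R * B).
  rewrite covE; apply: ler_sum => k _; apply: ler_sum => k' _.
  exact: le_trans (ler_norm _) (square_term _ _ _ Dj (ltn_ord k) (ltn_ord k')).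
apply: (le_trans S).
have badN : (\sum_(k < j) \sum_(k' < j) bad j k k' <= 5 * D * N)%N.
  rewrite /bad; under eq_bigr do rewrite !big_split/=.
  rewrite !big_split/=.
  have cst m l : (\sum_(k < j) \sum_(k' < j) (m <= k < m + l) <= l * j)%N.
    under eq_bigr do rewrite sum_nat_const card_ord.
    by rewrite -big_distrr/= mulnC leq_mul2r count_window orbT.
  have cst' m l : (\sum_(k < j) \sum_(k' < j) (m <= k' < m + l) <= l * j)%N.
    by rewrite exchange_big/=; exact: cst.
  have diag : (\sum_(k < j) \sum_(k' < j) (k == k' :> nat) <= j)%N.
    rewrite -[leqRHS]muln1 -[j in leqRHS]card_ord -sum_nat_const.
    apply: leq_sum => k _; rewrite (bigD1 k)//= eqxx big1// => i.
    by rewrite eq_sym -val_eqE/= => /negbTE ->.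
  have h1 := cst 0%N D; have h2 := cst (j - D)%N D.
  have h3 := cst' 0%N D; have h4 := cst' (j - D)%N D.
  have h5 : (D * j <= D * N)%N by rewrite leq_mul2l ltnW ?orbT.
  have h6 : (j <= D * N)%N by apply: leq_trans (ltnW jN) (leq_pmull _ D0).
  apply: (@leq_trans (D * j + D * j + (D * j + D * j) + j)%N); last lia.
  exact: (leq_add (leq_add (leq_add h1 h2) (leq_add h3 h4)) diag).
have -> : \sum_(k < j) \sum_(k' < j) (sig + (bad j k k')%:R * B) =
    j%:R ^+ 2 * sig + (\sum_(k < j) \sum_(k' < j) bad j k k')%:R * B.
  rewrite (eq_bigr (fun k : 'I_j => j%:R * sig + (\sum_(k' < j) bad j k k')%:R * B)).
    by rewrite big_split/= sumr_const card_ord -mulr_suml -natr_sum -[X in X + _]mulr_natl mulrA expr2.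
  by move=> k _; rewrite big_split/= sumr_const card_ord -mulr_suml -natr_sum -[X in X + _ = _]mulr_natl.
rewrite -[leLHS]add0r -[leRHS]addrA lerD//; first by rewrite mulr_ge0.
rewrite lerD//.
  by rewrite ler_wpM2r// ler_pXn2r ?nnegrE// ler_nat ltnW.
by rewrite ler_wpM2r// -!natrM ler_nat.
Qed.

(** For [|j - j'| < D], the arithmetic-geometric inequality reduces the covariance
    to the two second moments. *)
Lemma cross_bound (N j j' : nat) : (j < N)%N -> (j' < N)%N ->
  segint R s t (fun x => F j x * F j' x) <= N%:R ^+ 2 * sig +
    (j - (D - 1) <= j' < j - (D - 1) + 2 * D)%N%:R *
  (T * D%:R ^+ 2 + N%:R ^+ 2 * sig + 5 * D%:R * N%:R * (2 * w * T + sig)).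
Proof.
move=> jN jN'; have sig0 := sig_ge0; set V := T * _ + _ + _.
have V0 : 0 <= V.
  by apply: le_trans (square_bound _ _ jN); apply: segint_ge0 => x; rewrite -expr2 sqr_ge0.
have far i i' : (i < N)%N -> (i' < N)%N -> (i' + D <= i)%N ->
    segint R s t (fun x => F i x * F i' x) <= N%:R ^+ 2 * sig.
  move=> iN iN' ii; rewrite covE.
  apply: (@le_trans _ _ (\sum_(k < i) \sum_(k' < i') sig)).
    apply: ler_sum => k _; apply: ler_sum => k' _.
    exact: le_trans (ler_norm _) (far_covariance _ _ _ _ (ltn_ord k) (ltn_ord k') ii).
  rewrite sumr_const card_ord sumr_const card_ord -mulrnA -[leLHS]mulr_natl ler_wpM2r//.
  by rewrite -natrX ler_nat expnS expn1 leq_mul// ltnW.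
have add0 (b : bool) (Y : R) : Y <= N%:R ^+ 2 * sig -> Y <= N%:R ^+ 2 * sig + b%:R * V.
  by move=> h; apply: (le_trans h); rewrite lerDl mulr_ge0.
have [h1|h1] := leqP (j' + D) j; first exact/add0/far.
have [h2|h2] := leqP (j + D) j'.
  apply: add0; rewrite (@eq_segint _ _ _ _ (fun x => F j' x * F j x)); first exact: far.
  by move=> x _; rewrite mulrC.
have -> : (j - (D - 1) <= j' < j - (D - 1) + 2 * D)%N = true by lia.
rewrite mul1r -[leLHS]add0r lerD//; first by rewrite mulr_ge0// exprn_ge0.
apply: (@le_trans _ _ (2^-1 * (segint R s t (fun x => F j x * F j x) +
                               segint R s t (fun x => F j' x * F j' x)))).
  have bm i i' : bmeas R (fun x => F i x * F i' x) by exact: bmeasM.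
  rewrite -segintD// -segintZ; last exact: bmeasD.
  apply: le_segint => // [|x _]; first exact/bmeasZ/bmeasD.
  have := sqr_ge0 (F j x - F j' x); rewrite expr2; nra.
have := square_bound _ _ jN; have := square_bound _ _ jN'; rewrite -/V; lra.
Qed.

Lemma variance_bound (N : nat) :
  segint R s t (fun x => (\sum_(j < N) \sum_(k < j) ctri R w (x * (A j - A k))) ^+ 2) <=
  N%:R ^+ 4 * sig + 2 * D%:R * N%:R *
    (T * D%:R ^+ 2 + N%:R ^+ 2 * sig + 5 * D%:R * N%:R * (2 * w * T + sig)).
Proof.
set V := T * _ + _ + _.
have bm i i' : bmeas R (fun x => F i x * F i' x) by exact: bmeasM.
rewrite (@eq_segint _ _ _ _ (fun x => \sum_(j < N) \sum_(j' < N) (F j x * F j' x))); last first.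
  by move=> x _; rewrite expr2 big_distrlr.
rewrite segint_sum => [|j]; last exact: bmeas_sum.
apply: (@le_trans _ _ (\sum_(j < N) (N%:R ^+ 3 * sig + 2 * D%:R * V))); last first.
  by rewrite sumr_const card_ord -[leLHS]mulr_natl le_eqVlt; apply/orP; left; apply/eqP; ring.
apply: ler_sum => j _; rewrite segint_sum//.
have V0 : 0 <= V.
  by apply: le_trans (square_bound _ _ (ltn_ord j)); apply: segint_ge0 => x; rewrite -expr2 sqr_ge0.
apply: (@le_trans _ _ (\sum_(j' < N) (N%:R ^+ 2 * sig +
    (j - (D - 1) <= j' < j - (D - 1) + 2 * D)%N%:R * V))).
  by apply: ler_sum => j' _; exact: cross_bound.
rewrite big_split/= sumr_const card_ord -mulr_suml -natr_sum lerD//.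
  by rewrite -[leLHS]mulr_natl le_eqVlt; apply/orP; left; apply/eqP; ring.
by rewrite ler_wpM2r// -natrM ler_nat count_window.
Qed.

End VarianceBound.

(** * Almost everywhere convergence from summable second moments *)

Section AlmostEverywhere.
Context (R : realType).
Local Notation mu := (@lebesgue_measure R).

(** By monotone convergence the sum of the squares is integrable, hence finite
    almost everywhere, so that its terms tend to zero. *)
Lemma ae_cvg0_segint (s t M : R) (f : nat -> R -> R) :
  (forall m, bmeas R (f m)) ->
  (forall n, \sum_(m < n) segint R s t (fun x => f m x ^+ 2) <= M) ->
  {ae mu, forall x, s <= x <= t -> f m x @[m --> \oo] --> (0 : R)}.
Proof.
move=> bf fM.
have bf2 m : bmeas R (fun x => f m x ^+ 2) by exact: bmeasM.
pose g m x := (f m x ^+ 2)%:E.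
have g0 m x : (0 <= g m x)%E by rewrite lee_fin sqr_ge0.
have mg m : measurable_fun `[s, t] (g m).
  by apply/measurable_EFinP/measurable_funTS; case: (bf2 m).
have gE m : (\int[mu]_(x in `[s, t]) g m x)%E = (segint R s t (fun x => f m x ^+ 2))%:E.
  by rewrite /segint /Rintegral fineK//; apply: integrable_fin_num => //; exact: bmeas_integrable.
have intG : mu.-integrable `[s, t] (fun x => \sum_(m <oo) g m x)%E.
  apply/integrableP; split.
    by apply: (ge0_emeasurable_sum (P := xpredT)); [move=> k x _ _; exact: g0 | move=> k _; exact: mg].
  have -> : (\int[mu]_(x in `[s, t]) `|\sum_(m <oo) g m x|)%E =
      (\int[mu]_(x in `[s, t]) \sum_(m <oo) g m x)%E.
    by apply: eq_integral => x _; rewrite gee0_abs// nneseries_ge0.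
  rewrite integral_nneseries//.
  apply: (@le_lt_trans _ _ M%:E); last exact: ltry.
  apply: lime_le.
    by apply: is_cvg_nneseries => n _ _; exact: integral_ge0.
  apply: nearW => n; rewrite big_mkord.
  under eq_bigr do rewrite gE.
  by rewrite sumEFin lee_fin.
apply: filterS (integrable_ae _ intG) => // x Gx sxt.
have {}Gx : (\sum_(m <oo) g m x)%E \is a fin_num by apply: Gx; rewrite /= in_itv.
have cs : cvgn (series (fun m => f m x ^+ 2)).
  apply: nondecreasing_is_cvgn.
    by apply/nondecreasing_seqP => n; rewrite !seriesEnat/= big_nat_recr//= lerDl sqr_ge0.
  exists (fine (\sum_(m <oo) g m x)%E) => _ [n _ <-].
  rewrite -lee_fin fineK// seriesEnat/= -sumEFin.
  apply: (@nneseries_lim_ge _ (g ^~ x) xpredT 0%N n) => i _ _; exact: g0.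
have := cvg_series_cvg_0 cs.
move=> /(cvgrPdist_lt _ _).1 c; apply/cvgrPdist_lt => e e0.
near=> m; rewrite sub0r normrN.
have : `|0 - f m x ^+ 2| < e ^+ 2 by near: m; apply: c; exact: exprn_gt0.
rewrite sub0r normrN normrX ltr_pXn2r// nnegrE//; exact: ltW.
Unshelve. all: by end_near. Qed.

End AlmostEverywhere.

(** * A bound for the series of m^(-1-eps) *)

Section PSeries.
Context (R : realType).
(** The increment of [m^(-eps)] between consecutive integers dominates
    [eps (m+1)^(-1-eps)], by [ln x <= x - 1] and [1 + x <= exp x]. *)
Lemma pseries_step (eps m : R) : 0 < eps -> 1 <= m ->
  ((m + 1) * (m + 1) `^ eps)^-1 <= eps^-1 * ((m `^ eps)^-1 - ((m + 1) `^ eps)^-1).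
Proof.
move=> e0 m1.
have m0 : 0 < m by lra.
have m10 : 0 < m + 1 by lra.
have P0 : 0 < m `^ eps by exact: powR_gt0.
have P1 : 0 < (m + 1) `^ eps by exact: powR_gt0.
rewrite -ler_pdivrMl ?invr_gt0// invrK invfM.
suff h : 1 + eps / (m + 1) <= (m + 1) `^ eps / m `^ eps.
  have : (1 + eps / (m + 1)) * ((m + 1) `^ eps)^-1 <= (m + 1) `^ eps / m `^ eps * ((m + 1) `^ eps)^-1.
    by rewrite ler_pM2r// invr_gt0.
  rewrite mulrAC divff ?gt_eqF// mul1r mulrDl mul1r; lra.
have -> : (m + 1) `^ eps / m `^ eps = expR (eps * (- ln (m / (m + 1)))).
  rewrite lnM ?posrE ?invr_gt0// lnV ?posrE//.
  rewrite /powR !gt_eqF// -expRN -expRD; congr expR; ring.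
apply: (@le_trans _ _ (1 + eps * - ln (m / (m + 1)))); last exact: expR_ge1Dx.
rewrite lerD2l ler_pM2l//.
have := @le_ln1Dx R (m / (m + 1) - 1); rewrite subrKC.
have -> : m / (m + 1) - 1 = - (m + 1)^-1 by field; rewrite gt_eqF.
rewrite ltrN2 invf_lt1// ltrDr => /(_ m0); lra.
Qed.

Lemma pseries_bound (eps : R) (m0 n : nat) : 0 < eps -> (0 < m0)%N ->
  \sum_(i < n) ((m0 + i).+1%:R * (m0 + i).+1%:R `^ eps)^-1 <= eps^-1.
Proof.
move=> e0 m0p.
suff h : \sum_(i < n) ((m0 + i).+1%:R * (m0 + i).+1%:R `^ eps)^-1 <=
    eps^-1 * ((m0%:R `^ eps)^-1 - ((m0 + n)%:R `^ eps)^-1).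
  apply: (le_trans h); apply: ler_piMr; first by rewrite invr_ge0 ltW.
    have h1 : (m0%:R `^ eps)^-1 <= 1.
    rewrite invf_le1 ?powR_gt0 ?ltr0n//.
    have := @ge0_ler_powR R eps (ltW e0) 1 m0%:R.
    by rewrite !nnegrE powR1 ler01 ler0n ler1n; apply.
  have : 0 <= ((m0 + n)%:R `^ eps)^-1 by rewrite invr_ge0 powR_ge0.
  lra.
elim: n => [|n IH]; first by rewrite big_ord0 addn0 subrr mulr0.
rewrite big_ord_recr/=; apply: (le_trans (lerD IH _)).
  have := @pseries_step eps (m0 + n)%:R e0; rewrite natr1; apply.
  by rewrite ler1n addn_gt0 m0p.
by rewrite addnS -mulrDr addrA subrK.
Qed.
End PSeries.

(** * Choice of the block length and size of the variance *)

Section PairCorrelation.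
Context (R : realType).

Lemma ln_le (x : R) : 0 < x -> ln x <= x.
Proof.
move=> x0; have := @le_ln1Dx R (x - 1); rewrite subrKC => h.
apply: (le_trans (h _)); lra.
Qed.

(** [D] is about [12 ln m / ln C], and a logarithm grows more slowly than any
    power of [m].  The exponent 12 leaves room for the [N^4] quadruples of
    indices, with [N] of order [m^2], and for the factor [1 / w], which is at most
    of order [m^2]. *)
Lemma log_block_length (C eps : R) : 1 < C -> 0 < eps ->
  exists2 d : R, 0 < d & forall m : nat, (0 < m)%N ->
  exists D : nat, [/\ (0 < D)%N, C^-1 ^+ D <= (m%:R ^+ 12)^-1 & D%:R <= d * m%:R `^ eps].
Proof.
move=> C1 e0; have C0 : 0 < C by lra.
have lC : 0 < ln C by rewrite ln_gt0.
exists (12 / (eps * ln C) + 1); first by rewrite ltr_wpDl// divr_ge0// ltW// mulr_gt0.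
move=> m m0; have X0 : 0 < m%:R :> R by rewrite ltr0n.
have X1 : 1 <= m%:R :> R by rewrite ler1n.
have r0 : 0 < m%:R `^ eps by exact: powR_gt0.
have r1 : 1 <= m%:R `^ eps.
  have := @ge0_ler_powR R eps (ltW e0) 1 m%:R.
  by rewrite !nnegrE powR1 ler01 ler0n X1; apply.
have lX : 0 <= ln (m%:R : R) by rewrite ln_ge0.
exists (Num.truncn (12 * ln m%:R / ln C)).+1; split => //.
  rewrite exprVn lef_pV2 ?posrE ?exprn_gt0// -ler_ln ?posrE ?exprn_gt0//.
  rewrite !lnXn// -[leLHS]mulr_natl -[leRHS]mulr_natl -ler_pdivrMr//.
  by rewrite ltW// truncnS_gt.
rewrite -natr1; apply: (@le_trans _ _ (12 * ln m%:R / ln C + 1)).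
  by rewrite lerD2r truncn_le// divr_ge0 ?mulr_ge0// ltW.
rewrite [leRHS]mulrDl mul1r lerD//.
have : ln (m%:R `^ eps) <= m%:R `^ eps by exact: ln_le.
rewrite ln_powR => h.
have -> : 12 / (eps * ln C) * m%:R `^ eps = 12 * (eps^-1 * m%:R `^ eps) / ln C.
  by field; rewrite !gt_eqF.
by rewrite ler_pM2r ?invr_gt0// ler_pM2l// ler_pdivlMl.
Qed.

(** Size of the bound of [variance_bound] when [X = m], [r = m^e], [D = O(r)],
    [N = O(X^2)] and [w = O(1 / (X r^4))].  The main term is [D^2 N^2 w]; the
    condition [r^5 <= X] absorbs the term [D^3 N] that comes from the small
    indices. *)
Lemma variance_arith (X r D N w T q K d c K1 : R) :
  1 <= X -> 1 <= r -> r ^+ 5 <= X -> 0 <= D -> D <= d * r -> 0 <= N -> N <= 4 * X ^+ 2 ->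
  0 <= T -> 0 <= K -> 0 < c -> 0 < d -> 0 <= K1 -> c / X ^+ 2 <= w -> w <= K1 / (X * r ^+ 4) ->
  0 <= q -> q <= (X ^+ 12)^-1 ->
  N ^+ 4 * (K * q / w) + 2 * D * N * (T * D ^+ 2 + N ^+ 2 * (K * q / w) +
    5 * D * N * (2 * w * T + K * q / w)) <=
  (256 * (K / c) + 2 * d * 4 * (T * d ^+ 2 + 16 * (K / c) + 20 * d * (2 * K1 * T + K / c)))
  * (X ^+ 3 / r ^+ 2).
Proof.
move=> X1 r1 r5 D0 Dd N0 NX T0 K0 c0 d0 K10 wc wK q0 qX.
have X0 : 0 < X by lra.
have r0 : 0 < r by lra.
have w0 : 0 < w by apply: lt_le_trans wc; rewrite divr_gt0// exprn_gt0.
set sg := K * q / w; set s0 := K / c.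
have sg0 : 0 <= sg by rewrite /sg divr_ge0 ?mulr_ge0// ltW.
have s00 : 0 <= s0 by rewrite divr_ge0// ltW.
have sgX : sg <= s0 / X ^+ 10.
  have -> : s0 / X ^+ 10 = K * (X ^+ 12)^-1 * (c / X ^+ 2)^-1.
    by rewrite /s0; field; rewrite !gt_eqF.
  apply: ler_pM; rewrite ?mulr_ge0 ?invr_ge0 ?(ltW w0)//; first by rewrite ler_wpM2l.
  by rewrite lef_pV2 ?posrE// divr_gt0// exprn_gt0.
set E := X ^+ 3 / r ^+ 2.
have X20 : 0 < X ^+ 2 by rewrite exprn_gt0.
have r2X : r ^+ 2 <= X by apply: le_trans r5; rewrite ler_weXn2l.
have rX : r <= X by apply: le_trans r2X; rewrite -[leLHS]expr1 ler_weXn2l.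
have XE : X <= E.
  rewrite /E ler_pdivlMr ?exprn_gt0// -[X ^+ 3]/(X * (X * X)) ler_pM2l//.
  by apply: (le_trans r2X); rewrite ler_peMl// ltW.
have E1 : 1 <= E by lra.
have rE : r ^+ 3 * X ^+ 2 <= E.
  rewrite /E ler_pdivlMr ?exprn_gt0// mulrAC -exprD/= [X ^+ 3]exprS.
  by rewrite ler_pM2r.
have r21 : 1 <= r ^+ 2 by rewrite exprn_ege1.
have Nsg k : (k <= 4)%N -> N ^+ k * sg <= 4 ^+ k * s0.
  move=> k4; apply: (@le_trans _ _ ((4 * X ^+ 2) ^+ k * (s0 / X ^+ 10))).
    by apply: ler_pM => //; [exact: exprn_ge0 | rewrite lerXn2r// nnegrE mulr_ge0// ltW].
  rewrite exprMn -mulrA ler_pM2l ?exprn_gt0// -exprM mulrCA ler_piMr//.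
  rewrite ler_pdivrMr ?exprn_gt0// mul1r.
  by apply: ler_weXn2l => //; case: k k4 => [|[|[|[|[|k]]]]].
have D2 : D ^+ 2 <= d ^+ 2 * r ^+ 2 by rewrite -exprMn lerXn2r// nnegrE mulr_ge0// ltW.
have D3 : D ^+ 3 <= d ^+ 3 * r ^+ 3 by rewrite -exprMn lerXn2r// nnegrE mulr_ge0// ltW.
have N2 : N ^+ 2 <= 16 * X ^+ 4.
  have -> : 16 * X ^+ 4 = (4 * X ^+ 2) ^+ 2 by ring.
  by rewrite lerXn2r// nnegrE mulr_ge0// ltW.
have ta : N ^+ 4 * sg <= 256 * s0 * E.
  apply: (le_trans (Nsg 4%N isT)); have -> : 4 ^+ 4 * s0 = 256 * s0 :> R by ring.
  by have s1 := ler_wpM2l s00 E1; lra.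
have tb : D ^+ 3 * N <= 4 * d ^+ 3 * E.
  apply: (@le_trans _ _ (d ^+ 3 * r ^+ 3 * (4 * X ^+ 2))).
    by apply: ler_pM => //; exact: exprn_ge0.
  have -> : d ^+ 3 * r ^+ 3 * (4 * X ^+ 2) = 4 * d ^+ 3 * (r ^+ 3 * X ^+ 2) by ring.
  by rewrite ler_pM2l// mulr_gt0// exprn_gt0.
have tc : D * (N ^+ 3 * sg) <= 64 * d * s0 * E.
  apply: (@le_trans _ _ (d * E * (4 ^+ 3 * s0))).
    apply: ler_pM => //; [exact/mulr_ge0/sg0/exprn_ge0 | | exact: Nsg].
    by apply: (le_trans Dd); rewrite ler_pM2l//; lra.
  by rewrite le_eqVlt; apply/orP; left; apply/eqP; ring.
have td : D ^+ 2 * N ^+ 2 * w <= 16 * d ^+ 2 * K1 * E.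
  apply: (@le_trans _ _ (d ^+ 2 * r ^+ 2 * (16 * X ^+ 4) * (K1 / (X * r ^+ 4)))).
    apply: ler_pM => //; [|exact: ltW|].
      by apply: mulr_ge0; exact: exprn_ge0.
    by apply: ler_pM => //; exact: exprn_ge0.
  by rewrite le_eqVlt; apply/orP; left; apply/eqP; rewrite /E; field; rewrite !gt_eqF.
have te : D ^+ 2 * (N ^+ 2 * sg) <= 16 * d ^+ 2 * s0 * E.
  apply: (@le_trans _ _ (d ^+ 2 * E * (4 ^+ 2 * s0))).
    apply: ler_pM => //; [exact: exprn_ge0|exact/mulr_ge0/sg0/exprn_ge0 | | exact: Nsg].
    by apply: (le_trans D2); rewrite ler_pM2l ?exprn_gt0//; lra.
  by rewrite le_eqVlt; apply/orP; left; apply/eqP; ring.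
have -> : N ^+ 4 * sg + 2 * D * N * (T * D ^+ 2 + N ^+ 2 * sg + 5 * D * N * (2 * w * T + sg)) =
  N ^+ 4 * sg + 2 * T * (D ^+ 3 * N) + 2 * (D * (N ^+ 3 * sg)) +
  20 * T * (D ^+ 2 * N ^+ 2 * w) + 10 * (D ^+ 2 * (N ^+ 2 * sg)) by ring.
have tb' := ler_wpM2l T0 tb; have td' := ler_wpM2l T0 td.
have -> : (256 * s0 + 2 * d * 4 * (T * d ^+ 2 + 16 * s0 + 20 * d * (2 * K1 * T + s0))) * E =
  256 * s0 * E + 2 * (T * (4 * d ^+ 3 * E)) + 2 * (64 * d * s0 * E) +
  20 * (T * (16 * d ^+ 2 * K1 * E)) + 10 * (16 * d ^+ 2 * s0 * E) by ring.
lra.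
Qed.

End PairCorrelation.

(** * Almost everywhere convergence along the squares *)

Section PairCorrelation.
Context (R : realType).
Local Notation mu := (@lebesgue_measure R).
Variable a : nat -> R.
Hypothesis ha : lacunary a.

Definition discrepancy (N : nat) (w alpha : R) : R :=
  \sum_(j < N) \sum_(k < j) ctri R w (alpha * (a j.+1 - a k.+1)).

(** The quantity [w * N (N - 1) / 2] is the mean of the pair sum. *)
Lemma discrepancyE N w alpha :
  discrepancy N w alpha = paircount R a N w alpha - w * (N%:R * (N%:R - 1) / 2).
Proof.
rewrite /discrepancy /paircount /ctri.
elim: N => [|N IH]; first by rewrite !big_ord0 mul0r mul0r mulr0 subrr.
by rewrite !big_ord_recr/= IH sumrB sumr_const card_ord -mulr_natl -natr1; field.
Qed.

Lemma bmeas_discrepancy N w : 0 < w -> bmeas R (discrepancy N w).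
Proof.
move=> w0; apply: bmeas_sum => j; apply: bmeas_sum => k.
exact/bmeas_lincomp/bmeas_ctri.
Qed.

Lemma variance_decay (s t eps c K1 : R) : s <= t -> 0 < eps -> eps <= 5^-1 -> 0 < c -> 0 <= K1 ->
  exists B : R, forall (m N : nat) (w : R), (0 < m)%N -> (N <= 4 * m ^ 2)%N ->
  w <= 2^-1 -> c / m%:R ^+ 2 <= w -> w <= K1 / (m%:R * (m%:R `^ eps) ^+ 4) ->
  segint R s t (fun x => (discrepancy N w x / m%:R ^+ 2) ^+ 2) <=
  B * (m%:R * m%:R `^ (2 * eps))^-1.
Proof.
move=> st e0 e5 c0 K10; case: ha => a1 [C C1 aC].
have [d d0 dP] := log_block_length R C eps C1 e0.
have C0 : 0 < C by lra.
pose kap : R := 1 - C^-1.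
have kap0 : 0 < kap by apply: kap_gt0.
pose T := t - s; have T0 : 0 <= T by rewrite subr_ge0.
pose K : R := 2 * T / kap + (2 * T + 2) / (kap * a 1%N).
have K0 : 0 <= K.
  apply: addr_ge0; apply: divr_ge0; [lra|exact: ltW|lra|].
  exact/ltW/mulr_gt0.
exists (256 * (K / c) + 2 * d * 4 * (T * d ^+ 2 + 16 * (K / c) + 20 * d * (2 * K1 * T + K / c))).
move=> m N w m0 Nm w2 wc wK.
have X0 : 0 < m%:R :> R by rewrite ltr0n.
have X1 : 1 <= m%:R :> R by rewrite ler1n.
have w0 : 0 < w by apply: lt_le_trans wc; rewrite divr_gt0// exprn_gt0.
have [D [D0 Dq Dd]] := dP m m0.
have r0 : 0 < m%:R `^ eps :> R by exact: powR_gt0.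
have r1 : 1 <= m%:R `^ eps :> R.
  have := @ge0_ler_powR R eps (ltW e0) 1 m%:R.
  by rewrite !nnegrE powR1 ler01 ler0n X1; apply.
have rn n : (m%:R `^ eps) ^+ n = m%:R `^ (n%:R * eps) :> R.
  by rewrite -powR_mulrn ?powR_ge0// -powRrM mulrC.
have r5 : (m%:R `^ eps) ^+ 5 <= m%:R :> R.
  rewrite rn -[leRHS]powRr1 ?ler0n//; apply: ler_powR => //.
  by rewrite -ler_pdivlMl// mulr1.
have AC n : C * a n.+1 <= a n.+2 by exact: aC.
have V := @variance_bound R C (fun n => a n.+1) C1 a1 AC s t w D st w0 w2 D0 N.
have bd : bmeas R (fun x => discrepancy N w x ^+ 2).
  by apply: bmeasM; exact: bmeas_discrepancy.
rewrite (@eq_segint _ _ _ _ (fun x => (m%:R ^+ 4)^-1 * discrepancy N w x ^+ 2)); last first.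
  by move=> x _; field; rewrite gt_eqF.
rewrite segintZ// ler_pdivrMl ?exprn_gt0//.
apply: (le_trans V).
have q0 : 0 <= C^-1 ^+ D by rewrite exprn_ge0// invr_ge0 ltW.
have N4 : N%:R <= 4 * m%:R ^+ 2 :> R by rewrite -natrX -natrM ler_nat.
have := @variance_arith R m%:R (m%:R `^ eps) D%:R N%:R w T (C^-1 ^+ D) K d c K1
  X1 r1 r5 (ler0n _ _) Dd (ler0n _ _) N4 T0 K0 c0 d0 K10 wc wK q0 Dq.
move=> h; apply: (le_trans h); rewrite -rn le_eqVlt; apply/orP; left; apply/eqP.
by field; rewrite !gt_eqF.
Qed.

(** By [variance_decay] the second moments over [[- n, n]] are bounded by the
    terms of the series of [m^(-1-2e)].  The lower bound on [w] is there because
    the error terms of the covariance estimates contain [1 / w]. *)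
Lemma pair_discrepancy_ae (eps c K1 : R) (m0 : nat) (N : nat -> nat) (w : nat -> R) :
  0 < eps -> eps <= 5^-1 -> 0 < c -> 0 <= K1 ->
  (forall m, (m0 <= m)%N -> [/\ (N m <= 4 * m ^ 2)%N, w m <= 2^-1,
     c / m%:R ^+ 2 <= w m & w m <= K1 / (m%:R * (m%:R `^ eps) ^+ 4)]) ->
  {ae mu, forall alpha, discrepancy (N m) (w m) alpha / m%:R ^+ 2 @[m --> \oo] --> (0 : R)}.
Proof.
move=> e0 e5 c0 K10 hw.
have local (n : nat) : {ae mu, forall alpha, - n%:R <= alpha <= n%:R ->
    discrepancy (N m) (w m) alpha / m%:R ^+ 2 @[m --> \oo] --> (0 : R)}.
  have st : - n%:R <= n%:R :> R by rewrite lerNl -subr_ge0 opprK addr_ge0.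
  have [B BP] := variance_decay _ _ _ _ _ st e0 e5 c0 K10.
  (* The sequence is started beyond m0, where the hypotheses on w and N hold. *)
  pose k := m0.+1.
  pose f i x := discrepancy (N (k + i).+1) (w (k + i).+1) x / (k + i).+1%:R ^+ 2 : R.
  have wpos i : 0 < w (k + i).+1.
    have [] := hw (k + i).+1 _; first by rewrite /k; lia.
    move=> _ _ h _; apply: lt_le_trans h; rewrite divr_gt0// exprn_gt0//.
  have := @ae_cvg0_segint R (- n%:R) n%:R (`|B| * (2 * eps)^-1) f.
  have h1 : forall i, bmeas R (f i).
    move=> i; apply: bmeasM; [exact: bmeas_discrepancy|exact: bmeas_cst].
  have h2 : forall n', \sum_(i < n') segint R (- n%:R) n%:R (fun x => f i x ^+ 2) <=
      `|B| * (2 * eps)^-1.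
    move=> n'.
    apply: (@le_trans _ _ (\sum_(i < n') `|B| * ((k + i).+1%:R * (k + i).+1%:R `^ (2 * eps))^-1)).
      apply: ler_sum => i _.
      have [] := hw (k + i).+1 _; first by rewrite /k; lia.
      move=> g1 g2 g3 g4; apply: (le_trans (BP _ _ _ _ g1 g2 g3 g4)) => //.
      by apply: ler_wpM2r; [rewrite invr_ge0 mulr_ge0 ?powR_ge0 | exact: ler_norm].
    rewrite -mulr_sumr ler_wpM2l//; apply: pseries_bound => //; exact: mulr_gt0.
  move=> /(_ h1 h2) fcvg; apply: (@filterS _ _ (ae_filter_ringOfSetsType mu) _ _ _ fcvg) => alpha h na.
  rewrite -(cvg_shiftn k.+1); apply: cvg_trans (h na).
  apply: near_eq_cvg; apply: nearW => i /=.
  by rewrite /f addnS (addnC i).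
apply: (@filterS _ _ (ae_filter_ringOfSetsType mu) _ _ _ (ae_foralln local)) => alpha h.
apply: (h (Num.truncn `|alpha|).+1).
by rewrite -ler_norml ltW// truncnS_gt.
Qed.

End PairCorrelation.

(** * Sandwich between consecutive squares *)

Lemma floor_sqrt (N : nat) : exists m : nat, (m ^ 2 <= N < m.+1 ^ 2)%N.
Proof.
elim: N => [|N [m /andP[h1 h2]]]; first by exists 0%N.
have [h|h] := ltnP N.+1 (m.+1 ^ 2); first by exists m; rewrite h andbT ltnW.
by exists m.+1; rewrite h/=; move: h2; rewrite -!mulnn; nia.
Qed.

Section Sandwich.
Context (R : realType).
Implicit Types (X Nr l LN eta Q P : R).

(** Here [X = m], [l = L (m^2)], [Nr = N], and the second summand is the mean of
    the pair sum at [(m+1)^2] with the upper width.  Replacing [X] by [X + 1] in it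
    costs a relative error of at most [15 / X]. *)
Lemma upper_sandwich X Nr l eta Q : 1 <= X -> X ^+ 2 <= Nr -> 0 < eta -> 0 <= l ->
  15 * (l + eta) <= eta * X ->
  Q <= eta * X ^+ 2 +
    (l + eta) / X ^+ 2 * ((X + 1) ^+ 2 * ((X + 1) ^+ 2 - 1) / 2) ->
  2 * Q <= Nr * (l + 4 * eta).
Proof.
move=> X1 XN eta0 l0 hX hQ.
have X0 : 0 < X by lra.
have X20 : 0 < X ^+ 2 by rewrite exprn_gt0.
have h : (l + eta) / X ^+ 2 * ((X + 1) ^+ 2 * ((X + 1) ^+ 2 - 1)) <= (l + eta) * (X ^+ 2 + 15 * X).
  rewrite -mulrA ler_pM2l; last lra.
  rewrite ler_pdivrMl//.
  have -> : X ^+ 2 * (X ^+ 2 + 15 * X) =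
    (X + 1) ^+ 2 * ((X + 1) ^+ 2 - 1) + X * (11 * X ^+ 2 - 5 * X - 2) by ring.
  rewrite lerDl mulr_ge0//; first exact: ltW.
  nra.
apply: (@le_trans _ _ (X ^+ 2 * (l + 4 * eta))); last by rewrite ler_wpM2r//; lra.
have h2 : X * (15 * (l + eta)) <= X * (eta * X) by rewrite ler_pM2l.
rewrite expr2 in hQ h *; nra.
Qed.

(** Counterpart of [upper_sandwich] at [m^2] with the lower width, where the
    relative error is at most [5 / X]. *)
Lemma lower_sandwich X Nr l eta Q : 1 <= X -> Nr <= (X + 1) ^+ 2 -> 0 < eta ->
  4 * eta <= l -> 15 * (l + eta) <= eta * X ->
  - (eta * X ^+ 2) +
    (l - eta) / (X + 1) ^+ 2 * (X ^+ 2 * (X ^+ 2 - 1) / 2) <= Q ->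
  Nr * (l - 4 * eta) <= 2 * Q.
Proof.
move=> X1 XN eta0 l0 hX hQ.
have X0 : 0 < X by lra.
have X20 : 0 < (X + 1) ^+ 2 by rewrite exprn_gt0//; lra.
have h : (l - eta) * ((X + 1) ^+ 2 - 5 * X) <= (l - eta) / (X + 1) ^+ 2 * (X ^+ 2 * (X ^+ 2 - 1)).
  rewrite -[leRHS]mulrA ler_pM2l; last lra.
  rewrite ler_pdivlMl//.
  have -> : X ^+ 2 * (X ^+ 2 - 1) =
    (X + 1) ^+ 2 * ((X + 1) ^+ 2 - 5 * X) + (X + 1) * (X ^+ 2 + 2 * X - 1) by ring.
  rewrite lerDl mulr_ge0//; nra.
apply: (@le_trans _ _ ((X + 1) ^+ 2 * (l - 4 * eta))); first by rewrite ler_wpM2r//; lra.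
have h2 : X * (15 * (l + eta)) <= X * (eta * X) by rewrite ler_pM2l.
rewrite !expr2 in hQ h *; nra.
Qed.
End Sandwich.

(** * The hypotheses on the window *)

Section WindowHypotheses.
Context (R : realType).
Variable (L : nat -> R).

(** There are [2 m + 1 <= 3 m] steps between consecutive squares, and each is at
    most [eta / 3 * m^-1]. *)
Lemma slow_variation :
  ((fun N : nat => L N.+1 - L N) =o_\oo (fun N : nat => N%:R `^ (- 2^-1) : R)) ->
  forall eta : R, 0 < eta -> exists M : nat, forall m N : nat,
  (M <= m)%N -> (m ^ 2 <= N <= m.+1 ^ 2)%N -> `|L N - L (m ^ 2)%N| <= eta.
Proof.
move=> /eqoP hL eta eta0.
have e3 : 0 < eta / 3 by rewrite divr_gt0.
have [M _ MP] := hL _ e3.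
exists M.+1 => m N Mm /andP[mN Nm].
have m0 : (0 < m)%N by lia.
have X0 : 0 < m%:R :> R by rewrite ltr0n.
have step i : (m ^ 2 <= i)%N -> `|L i.+1 - L i| <= eta / 3 * m%:R^-1.
  move=> mi; have Mi : (M <= i)%N.
    by apply: leq_trans mi; rewrite -mulnn; nia.
  have := MP i Mi => /= h; apply: (le_trans h).
  rewrite ler_pM2l// ger0_norm ?powR_ge0//.
  have -> : m%:R^-1 = ((m ^ 2)%:R) `^ (- 2^-1) :> R.
    by rewrite natrX -powR_mulrn// -powRrM mulrN divff// powR_inv1.
  have i0 : (0 < i)%N by apply: leq_trans mi; rewrite expn_gt0 m0.
  rewrite !powRN lef_pV2 ?posrE ?powR_gt0 ?ltr0n ?expn_gt0 ?m0//.
  by apply: ge0_ler_powR; rewrite ?nnegrE ?ler0n// ler_nat.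
have key n : `|L (m ^ 2 + n)%N - L (m ^ 2)%N| <= n%:R * (eta / 3 * m%:R^-1).
  elim: n => [|n IH]; first by rewrite addn0 subrr normr0 mul0r.
  rewrite addnS -natr1 mulrDl mul1r.
  have -> : L (m ^ 2 + n).+1 - L (m ^ 2)%N =
    (L (m ^ 2 + n)%N - L (m ^ 2)%N) + (L (m ^ 2 + n).+1 - L (m ^ 2 + n)%N) by ring.
  by apply: (le_trans (ler_normD _ _)); rewrite lerD// step// leq_addr.
have := key (N - m ^ 2)%N; rewrite subnKC// => h; apply: (le_trans h).
have -> : (N - m ^ 2)%:R * (eta / 3 * m%:R^-1) = eta * ((N - m ^ 2)%:R / (3 * m%:R)) :> R.
  by field; rewrite gt_eqF.
apply: ler_piMr; first exact: ltW.
rewrite ler_pdivrMr ?mulr_gt0// mul1r -natrM ler_nat.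
by move: Nm; rewrite -!mulnn; nia.
Qed.

(** With [r = m^e] the hypothesis gives [L (m^2) = O(m / r^4)], the form in which
    it enters [variance_arith]. *)
Lemma growth_along_squares (eps e : R) : 0 < e -> 2 * e <= eps ->
  (L =O_\oo (fun N : nat => N%:R `^ (2^-1 - eps) : R)) ->
  exists2 K : R, 0 < K & exists M : nat, forall m : nat, (M <= m)%N -> (0 < m)%N ->
  L (m ^ 2)%N <= K * (m%:R / (m%:R `^ e) ^+ 4).
Proof.
move=> e0 ee /eqOP [K0 [_ KP]].
pose K := Num.max K0 0 + 1.
have K0K : K0 < K by rewrite /K; have := le_max K0 K0 0; rewrite lexx/=; lra.
have Kp : 0 < K by rewrite /K; have := le_max 0 K0 0; rewrite lexx orbT/=; lra.
have [M _ MP] := KP K K0K.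
exists K => //; exists M => m Mm m0.
have X0 : 0 < m%:R :> R by rewrite ltr0n.
have X1 : 1 <= m%:R :> R by rewrite ler1n.
have Mm2 : (M <= m ^ 2)%N by rewrite -mulnn; nia.
have h : `|L (m ^ 2)%N| <= K * `|(m ^ 2)%:R `^ (2^-1 - eps)| := MP _ Mm2.
apply: (le_trans (ler_norm _)); apply: (le_trans h).
rewrite ler_pM2l// ger0_norm ?powR_ge0//.
have -> : m%:R / (m%:R `^ e) ^+ 4 = m%:R `^ (1 - 4 * e) :> R.
  rewrite -powR_mulrn ?powR_ge0// -powRrM powRB; last by rewrite pnatr_eq0 -lt0n m0 implybT.
  by rewrite powRr1// [4 * e]mulrC.
rewrite natrX -powR_mulrn// -powRrM ler_powR//; lra.
Qed.

End WindowHypotheses.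

(** * Conclusion *)

Section Widths.
Context (R : realType).
Local Notation mu := (@lebesgue_measure R).
Variables (a L : nat -> R).
Hypothesis ha : lacunary a.
Hypothesis Lpos : forall N : nat, (1 <= N)%N -> 0 < L N.
Variables (e K : R) (M : nat).
Hypotheses (e0 : 0 < e) (e5 : e <= 5^-1) (K0 : 0 < K).
Hypothesis growth : forall m : nat, (M <= m)%N -> (0 < m)%N ->
  L (m ^ 2)%N <= K * (m%:R / (m%:R `^ e) ^+ 4).

Definition upper_width (eta : R) (m : nat) : R := (L (m ^ 2)%N + eta) / m%:R ^+ 2.

(** The maximum keeps the width at least of order [1 / m^2], even if [L] is tiny.
    When it differs from [L (m^2) - eta], the lower estimate of the pair sum is
    implied by its positivity. *)
Definition lower_width (eta : R) (m : nat) : R :=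
  Num.max (L (m ^ 2)%N - eta) eta / (m%:R + 1) ^+ 2.

Lemma powR_large (Y : R) : exists M' : nat, forall m : nat, (M' <= m)%N -> Y <= m%:R `^ e.
Proof.
have [Y0|Y0] := leP Y 0; first by exists 0%N => m _; apply: (le_trans Y0); exact: powR_ge0.
exists (Num.truncn (Y `^ e^-1)).+1 => m hm.
have h : Y `^ e^-1 <= m%:R.
  by rewrite (le_trans (ltW (truncnS_gt _)))// ler_nat.
have -> : Y = (Y `^ e^-1) `^ e by rewrite -powRrM mulVf ?gt_eqF// powRr1// ltW.
by apply: ge0_ler_powR; rewrite ?nnegrE ?powR_ge0// ltW.
Qed.

Lemma widths_admissible (eta : R) : 0 < eta -> exists m0 : nat, forall m, (m0 <= m)%N ->
  [/\ (0 < m)%N, upper_width eta m <= 2^-1,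
   eta / 4 / m%:R ^+ 2 <= lower_width eta m,
   lower_width eta m <= upper_width eta m &
   upper_width eta m <= (K + eta) / (m%:R * (m%:R `^ e) ^+ 4)].
Proof.
move=> eta0; exists (maxn M (Num.truncn (2 * (K + eta))).+1) => m; rewrite geq_max => /andP[Mm hm].
have m0 : (0 < m)%N by lia.
have X1 : 1 <= m%:R :> R by rewrite ler1n.
have X0 : 0 < m%:R :> R by rewrite ltr0n.
have r00 : 0 < m%:R `^ e :> R by exact: powR_gt0.
have r1 : 1 <= (m%:R `^ e) ^+ 4 :> R.
  apply: exprn_ege1; have := @ge0_ler_powR R e (ltW e0) 1 m%:R.
  by rewrite !nnegrE powR1 ler01 ler0n X1; apply.
have r0 : 0 < (m%:R `^ e) ^+ 4 :> R by lra.
have rX : (m%:R `^ e) ^+ 4 <= m%:R :> R.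
  rewrite -powR_mulrn ?powR_ge0// -powRrM -[leRHS]powRr1//.
  by rewrite ler_powR//; have := e5; lra.
have L0 : 0 < L (m ^ 2)%N by apply: Lpos; rewrite expn_gt0 m0.
have up : upper_width eta m <= (K + eta) / (m%:R * (m%:R `^ e) ^+ 4).
  rewrite /upper_width ler_pdivrMr ?exprn_gt0//.
  have -> : (K + eta) / (m%:R * (m%:R `^ e) ^+ 4) * m%:R ^+ 2 =
     K * (m%:R / (m%:R `^ e) ^+ 4) + eta * (m%:R / (m%:R `^ e) ^+ 4).
    by field; rewrite !gt_eqF.
  rewrite lerD ?growth// ler_peMr ?(ltW eta0)//.
  by rewrite ler_pdivlMr// mul1r.
have s1 : m%:R ^+ 2 <= (m%:R + 1) ^+ 2 :> R by rewrite lerXn2r// ?nnegrE; lra.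
have s2 : (m%:R + 1) ^+ 2 <= 4 * m%:R ^+ 2 :> R.
  have -> : 4 * m%:R ^+ 2 = (2 * m%:R) ^+ 2 :> R by ring.
  by rewrite lerXn2r// ?nnegrE; lra.
have p2 : 0 < m%:R ^+ 2 :> R by rewrite exprn_gt0.
have p3 : 0 < (m%:R + 1) ^+ 2 :> R by lra.
split => //.
- apply: (le_trans up); rewrite ler_pdivrMr ?mulr_gt0//.
  have hK : 2 * (K + eta) <= m%:R.
    by rewrite (le_trans (ltW (truncnS_gt _)))// ler_nat.
  apply: (@le_trans _ _ (2^-1 * m%:R)); first lra.
  by rewrite ler_pM2l// ler_peMr// ltW.
- rewrite /lower_width; apply: (@le_trans _ _ (eta / (m%:R + 1) ^+ 2)).
    by rewrite -mulrA -invfM ler_pM2l// lef_pV2// posrE mulr_gt0.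
  by rewrite ler_pM2r ?invr_gt0// le_max lexx orbT.
- rewrite /lower_width /upper_width; apply: ler_pM.
  + by rewrite le_max (ltW eta0) orbT.
  + by rewrite invr_ge0 ltW.
  + by rewrite ge_max; apply/andP; split; lra.
  + by rewrite lef_pV2.
Qed.

(** Both widths are deterministic, so one null set serves the two convergences. *)
Lemma discrepancies_vanish (eta : R) : 0 < eta ->
  {ae mu, forall alpha,
    discrepancy R a (m.+1 ^ 2)%N (upper_width eta m) alpha / m%:R ^+ 2 @[m --> \oo] --> (0 : R) /\
    discrepancy R a (m ^ 2)%N (lower_width eta m) alpha / m%:R ^+ 2 @[m --> \oo] --> (0 : R)}.
Proof.
move=> eta0; have [m0 hm0] := widths_admissible eta eta0.
have c0 : 0 < eta / 4 by rewrite divr_gt0.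
have K10 : 0 <= K + eta by have := K0; lra.
have up := @pair_discrepancy_ae R a ha e (eta / 4) (K + eta) m0
  (fun m => (m.+1 ^ 2)%N) (upper_width eta) e0 e5 c0 K10.
have lo := @pair_discrepancy_ae R a ha e (eta / 4) (K + eta) m0
  (fun m => (m ^ 2)%N) (lower_width eta) e0 e5 c0 K10.
apply: (@filterS2 _ _ (ae_filter_ringOfSetsType mu) _ _ _ _ (up _) (lo _)).
- by move=> alpha; split.
- move=> m /hm0[mp h1 h2 h3 h4]; split => //; last exact: le_trans h3.
  by rewrite -[4%N]/(2 ^ 2)%N -expnMn leq_exp2r// mul2n -addnn -addn1 leq_add2l.
- move=> m /hm0[mp h1 h2 h3 h4]; split => //; [|exact: le_trans h1|exact: le_trans h4].
  by rewrite leq_pmull.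
Qed.

End Widths.

Theorem theorem1p2 (R : realType) (a : nat -> R) (ha : lacunary a)
    (eps : R) (heps : 0 < eps) (L : nat -> R)
    (hLpos : forall N : nat, (1 <= N)%N -> 0 < L N)
    (hLO : L =O_\oo (fun N : nat => N%:R `^ (2^-1 - eps)))
    (hLo : (fun N : nat => L N.+1 - L N)
             =o_\oo (fun N : nat => N%:R `^ (- 2^-1))) :
  {ae @lebesgue_measure R, forall alpha : R,
    (fun N : nat => Sigma2 a N (L N) alpha) = L +o_\oo L}.
Proof.
(* The bound e <= 1/5 is what makes m^(5 e) <= m; decreasing eps is harmless. *)
pose e := Num.min eps (2 / 5) / 2.
have e0 : 0 < e by rewrite divr_gt0// lt_min heps/=; lra.
have e5 : e <= 5^-1 by have := ge_min (2 / 5) eps (2 / 5); rewrite lexx orbT /e; lra.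
have ee : 2 * e <= eps by have := ge_min eps eps (2 / 5); rewrite lexx /e; lra.
have [K K0 [M growth]] := growth_along_squares R L eps e e0 ee hLO.
have van (p : nat) := discrepancies_vanish R a L ha hLpos e K M e0 e5 K0 growth
  p.+1%:R^-1 (harmonic_gt0 p).
apply: (@filterS _ _ (ae_filter_ringOfSetsType lebesgue_measure) _ _ _ (ae_foralln van)).
move=> alpha {}van; apply/eqaddoP => del del0.
pose p := Num.truncn (5 / del); pose eta : R := p.+1%:R^-1.
have eta0 : 0 < eta by exact: harmonic_gt0.
have eta1 : eta <= 1 by rewrite invf_le1 ?ltr0n// ler1n.
have eta_del : 5 * eta <= del.
  rewrite /eta ler_pdivrMr ?ltr0n// mulrC -ler_pdivrMr//.
  exact/ltW/truncnS_gt.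
have [/(cvgrPdist_le _ _).1/(_ _ eta0)[M1 _ up] /(cvgrPdist_le _ _).1/(_ _ eta0)[M2 _ lo]] := van p.
have [M3 slow] := slow_variation R L hLo eta eta0.
have [M4 large] := powR_large R e e0 (30 * K / eta + 1).
pose M0 := maxn M1 (maxn M2 (maxn M3 (maxn M4 (maxn 30 M)))).
exists (M0 ^ 2)%N => // N /= M0N.
have [m /andP[mN Nm]] := floor_sqrt N.
have Mm : (M0 <= m)%N.
  rewrite leqNgt; apply/negP => mM; move: M0N; apply/negP; rewrite -ltnNge.
  by apply: (leq_trans Nm); rewrite leq_exp2r.
move: (Mm); rewrite !geq_max => /and5P[M1m M2m M3m M4m /andP[m30 MM]].
have m0 : (0 < m)%N by exact: leq_trans m30.
have N0 : (0 < N)%N by apply: leq_trans mN; rewrite expn_gt0 m0.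
have X30 : 30 <= m%:R :> R by rewrite ler_nat.
have X1 : 1 <= m%:R :> R by lra.
have X0 : 0 < m%:R :> R by lra.
have NR : 0 < N%:R :> R by rewrite ltr0n.
have XN : m%:R ^+ 2 <= N%:R :> R by rewrite -natrX ler_nat.
have NX : N%:R <= (m%:R + 1) ^+ 2 :> R by rewrite natr1 -natrX ler_nat ltnW.
have {up} := up m M1m; rewrite sub0r normrN => up.
have {lo} := lo m M2m; rewrite sub0r normrN => lo.
set l := L (m ^ 2)%N.
have l0 : 0 < l by apply: hLpos; rewrite expn_gt0 m0.
have {}slow : `|L N - l| <= eta.
  by apply: slow; rewrite // mN ltnW.
have LN0 : 0 < L N by exact: hLpos.
have lX : 15 * (l + eta) <= eta * m%:R.
  have r1 : 30 * K / eta + 1 <= m%:R `^ e by exact: large.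
  have Ke : 0 < 30 * K / eta by rewrite divr_gt0// mulr_gt0.
  have r4 : 30 * K / eta <= (m%:R `^ e) ^+ 4.
    apply: (@le_trans _ _ (m%:R `^ e)); first lra.
    by rewrite -[leLHS]expr1 ler_weXn2l//; lra.
  have r40 : 0 < (m%:R `^ e) ^+ 4 :> R by lra.
  have h : l <= K * (m%:R / (m%:R `^ e) ^+ 4).
    exact: growth.
  have h2 : 30 * (K * (m%:R / (m%:R `^ e) ^+ 4)) <= eta * m%:R.
    have -> : 30 * (K * (m%:R / (m%:R `^ e) ^+ 4)) = 30 * K * m%:R / (m%:R `^ e) ^+ 4.
      by rewrite !mulrA.
    rewrite ler_pdivrMr//; move: r4; rewrite ler_pdivrMr// => r4.
    have := ler_wpM2l (ltW X0) r4; lra.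
  nra.
have slow' : l - eta <= L N <= l + eta by move: slow; rewrite ler_norml; lra.
have w0 : 0 < L N / N%:R by rewrite divr_gt0.
have m2 : 0 < m%:R ^+ 2 :> R by rewrite exprn_gt0.
have m12 : 0 < (m%:R + 1) ^+ 2 :> R by rewrite exprn_gt0//; lra.
have w2 : L N / N%:R < 2^-1.
  rewrite ltr_pdivrMr//; move: XN; rewrite expr2 => XN; nra.
set Q := paircount R a N (L N / N%:R) alpha.
have Qup : 2 * Q <= N%:R * (l + 4 * eta).
  apply: (upper_sandwich R m%:R) => //; first exact: ltW.
  apply: (@le_trans _ _ (paircount R a (m.+1 ^ 2)%N (upper_width R L eta m) alpha)).
    apply: le_paircount => //; first exact: ltnW.
    rewrite /upper_width -/l; apply: ler_pM; [exact: ltW|by rewrite invr_ge0 ltW|lra|].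
    by rewrite lef_pV2.
  rewrite -lerBlDr -/l -/(upper_width R L eta m) natr1 -natrX -discrepancyE.
  by rewrite -ler_pdivrMr//; move: up; rewrite ler_norml => /andP[].
have Qlo : N%:R * (L N - 5 * eta) <= 2 * Q.
  have Q0 : 0 <= Q by exact: paircount_ge0.
  (* If L N is small, positivity suffices; otherwise the maximum in lower_width is L (m^2) - eta. *)
  have [L5|L5] := leP (L N) (5 * eta).
    by apply: (@le_trans _ _ 0); [rewrite mulr_ge0_le0// subr_le0 | rewrite mulr_ge0].
  apply: (@le_trans _ _ (N%:R * (l - 4 * eta))); first by rewrite ler_pM2l//; lra.
  apply: (lower_sandwich R m%:R) => //; first lra.
  have lE : lower_width R L eta m = (l - eta) / (m%:R + 1) ^+ 2.
    by rewrite /lower_width -/l max_l//; lra.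
  apply: (@le_trans _ _ (paircount R a (m ^ 2)%N (lower_width R L eta m) alpha)); last first.
    apply: le_paircount => //; rewrite lE; first by rewrite divr_gt0//; lra.
    apply: ler_pM; [lra|by rewrite invr_ge0 ltW|lra|].
    by rewrite lef_pV2.
  rewrite -lerBrDr -lE -natrX -discrepancyE natrX -mulNr -ler_pdivlMr//.
  by move: lo; rewrite ler_norml => /andP[].
rewrite [X in `|X|](_ : _ = Sigma2 a N (L N) alpha - L N)// Sigma2E ?w0//.
rewrite -/Q [X in `|X|](_ : _ = (2 * Q / N%:R - L N) * L N); last first.
  by field; rewrite gt_eqF.
rewrite normrM ler_pM2r ?normr_gt0 ?gt_eqF//; apply: le_trans eta_del.
have h1 : 2 * Q / N%:R <= l + 4 * eta by rewrite ler_pdivrMr// [leRHS]mulrC.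
have h2 : L N - 5 * eta <= 2 * Q / N%:R.
  by rewrite ler_pdivlMr// [leLHS]mulrC.
rewrite ler_norml; lra.
Qed.
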